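(* Let $\mathsf{M}=(E,\operatorname{rk})$ be a nonempty loopless polymatroid (i.e. $E\neq\varnothing$) and let $\mathcal{G}$ be a building set on $\mathcal{L}(\mathsf{M})$. Then, as an identity of rational functions in $x$, \[ \mathrm{H}_\mathsf{M}^\mathcal{G}(x) = \sum_{\varnothing \neq F \in \mathcal L(\mathsf{M})} \frac{-\chi_{\mathsf{M}|_F}(x)}{(1-x)^{|f(\mathcal{G}|_F)|}} \cdot \mathrm{H}_{\mathsf{M}/F}^{\mathcal{G}/F}(x), \] and \[ \mathrm{H}_\mathsf{M}^{\mathcal{G}}(x) = \sum_{E\neq F \in \mathcal L(\mathsf{M})} \mathrm{H}_{\mathsf{M}|_F}^{\mathcal{G}|_F}(x) \cdot \frac{-\chi_{\mathsf{M}/F}(x)}{(1-x)^{\lvert f(\mathcal{G}/F) \rvert}}. \]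
   Context: A polymatroid $\mathsf{M}=(E,\operatorname{rk})$ consists of a finite set $E$ and a function $\operatorname{rk}:2^E\to\mathbb{Z}_{\ge0}$ with $\operatorname{rk}(\varnothing)=0$, $\operatorname{rk}(A_1)\le\operatorname{rk}(A_2)$ whenever $A_1\subseteq A_2$, and $\operatorname{rk}(A_1)+\operatorname{rk}(A_2)\ge\operatorname{rk}(A_1\cup A_2)+\operatorname{rk}(A_1\cap A_2)$. A flat is a set $F\subseteq E$ with $\operatorname{rk}(F\cup\{e\})>\operatorname{rk}(F)$ for all $e\in E\setminus F$; the flats ordered by inclusion form a lattice $\mathcal L(\mathsf{M})$ with join $\vee$. Loopless means $\varnothing\in\mathcal L(\mathsf{M})$. For a set $\mathcal{G}$ of flats, $f(\mathcal{G})$ denotes the set of inclusion-maximal elements of $\mathcal{G}$ (the $\mathcal{G}$-factors), and $\mathcal{G}_{\le F}=\{G\in\mathcal{G}:G\subseteq F\}$. A building set is a subset $\mathcal{G}\subseteq\mathcal L(\mathsf{M})\setminus\{\varnothing\}$ such that for every flat $F$ the lattice map $\prod_{G\in f(\mathcal{G}_{\le F})}[\varnothing,G]\to[\varnothing,F]$, $(F_G)_G\mapsto\bigvee_G F_G$, is an isomorphism and $\operatorname{rk}(F)=\sum_{G\in f(\mathcal{G}_{\le F})}\operatorname{rk}(G)$. For a flat $F$: the restriction $\mathsf{M}|_F=(F,\operatorname{rk}|_{2^F})$, with induced building set $\mathcal{G}|_F=\{G\in\mathcal{G}:G\subseteq F\}$; the contraction $\mathsf{M}/F$ is the polymatroid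 on $E\setminus F$ with rank $A\mapsto\operatorname{rk}(A\cup F)-\operatorname{rk}(F)$, whose lattice of flats is identified with the interval $[F,E]$ of $\mathcal L(\mathsf{M})$, with induced building set $\mathcal{G}/F=\{G\vee F: G\in\mathcal{G},\ G\not\subseteq F\}$. The characteristic polynomial is $\chi_\mathsf{M}(x)=\sum_{F\in\mathcal L(\mathsf{M})}\mu(\varnothing,F)x^{\operatorname{rk}(E)-\operatorname{rk}(F)}$, $\mu$ the Möbius function of $\mathcal L(\mathsf{M})$. The Chow ring $D(\mathsf{M},\mathcal{G})$ is the quotient of $\mathbb{Q}[x_G:G\in\mathcal{G}]$ (each $x_G$ of degree 1) by the ideal generated by $\big(\prod_{i=1}^m x_{G_i}\big)\big(\sum_{H\in\mathcal{G},H\supseteq G}x_H\big)^{b}$ for every subset $S=\{G_1,\dots,G_m\}\subseteq\mathcal{G}$ and every $G\in\mathcal{G}$, where $b=\operatorname{rk}(G)-\operatorname{rk}(\sup(S,G))$ and $\sup(S,G)=\bigvee_{G'\in S,\,G'\subsetneq G}G'$ (empty join $=\varnothing$). It is a graded Artinian ring, and $\mathrm{H}_\mathsf{M}^{\mathcal{G}}(x)=\sum_i\dim_\mathbb{Q} D^i(\mathsf{M},\mathcal{G})x^i$ is its Hilbert series; by convention $\mathrm{H}^{\mathcal{G}}_\mathsf{M}(x)=1$ when $\mathsf{M}$ is the empty polymatroid (ground set $\varnothing$). *)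

(* Defs.v *)
From HB Require Import structures.
From mathcomp Require Import all_boot all_order all_algebra.
From mathcomp Require Import generic_quotient ring_quotient fraction.
From mathcomp Require Import boolp.
From mathcomp Require classical_sets.
From mathcomp Require Import mpoly.

Set Implicit Arguments.
Unset Strict Implicit.
Unset Printing Implicit Defensive.

Import GRing.Theory.
Local Open Scope ring_scope.

Section Polymatroids.
Variable T : finType.

(* A finite set [ground M] inside an ambient finite type, with a function on
   its subsets; the values of [rk M] outside [powerset (ground M)] are
   irrelevant. *)
Record ranked_set := RankedSet { ground : {set T}; rk : {set T} -> nat }.

Implicit Types (M : ranked_set) (A B F G : {set T}) (P S GG : {set {set T}}).

Definition polymatroid M : Prop :=
  [/\ rk M set0 = 0%N,
      forall A B, A \subset B -> B \subset ground M -> (rk M A <= rk M B)%N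
    & forall A B, A \subset ground M -> B \subset ground M ->
        (rk M (A :|: B) + rk M (A :&: B) <= rk M A + rk M B)%N].

Definition flats M : {set {set T}} :=
  [set F in powerset (ground M) |
    [forall e in ground M :\: F, rk M F < rk M (e |: F)]%N].

Definition loopless M : bool := set0 \in flats M.

Definition interval M A B : {set {set T}} :=
  [set F in flats M | (A \subset F) && (F \subset B)].

(* The least upper bound in the lattice of flats (see [joinP]). *)
Definition join M S : {set T} := \bigcap_(F in flats M | cover S \subset F) F.

Definition restriction M F : ranked_set := RankedSet F (rk M).

Definition contraction M F : ranked_set :=
  RankedSet (ground M :\: F) (fun A => rk M (A :|: F) - rk M F)%N.

Fixpoint mobius_rec P A (n : nat) B : int :=
  if n is n'.+1 then
    if A == B then 1
    else - \sum_(C in P | (A \subset C) && (C \proper B)) mobius_rec P A n' C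
  else 0.

(* The Moebius function of P ordered by inclusion; the recursion depth #|B|.+1
   suffices, see [mobiusE]. *)
Definition mobius P A B : int := mobius_rec P A #|B|.+1 B.

Definition chi M : {poly rat} :=
  \sum_(F in flats M)
    (mobius (flats M) set0 F)%:~R *: 'X^(rk M (ground M) - rk M F).

Definition factors GG : {set {set T}} := [set G | maxset (mem GG) G].

Definition below GG F : {set {set T}} := [set G in GG | G \subset F].

(* The product of the lattices [0, G], G in GG; a family indexed by GG is
   represented by its extension by set0 to all of {set T}. *)
Definition interval_prod M GG : {pred {ffun {set T} -> {set T}}} :=
  pfamily set0 GG (interval M set0).

Definition join_map M GG (phi : {ffun {set T} -> {set T}}) : {set T} :=
  join M [set phi G | G in GG].

Definition join_map_iso M GG F : Prop :=
  [/\ {in interval_prod M GG &, injective (join_map M GG)},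
      [set join_map M GG phi | phi in interval_prod M GG] = interval M set0 F
    & {in interval_prod M GG &, forall phi psi,
        (join_map M GG phi \subset join_map M GG psi)
          = [forall G in GG, phi G \subset psi G]}].

Definition building_set M GG : Prop :=
  GG \subset flats M :\ set0 /\
  forall F, F \in flats M ->
    join_map_iso M (factors (below GG F)) F /\
    rk M F = (\sum_(G in factors (below GG F)) rk M G)%N.

Definition building_restr GG F : {set {set T}} := below GG F.

(* The flats of M / F are the sets H :\: F for H in the interval [F, E] of the
   lattice of flats of M. *)
Definition building_contr M GG F : {set {set T}} :=
  [set join M [set G; F] :\: F | G in GG & ~~ (G \subset F)].

Definition sup_below M S G : {set T} := join M [set H in S | H \proper G].

Lemma flatsP M F :
  reflect (F \subset ground M /\
           forall e, e \in ground M -> e \notin F -> (rk M F < rk M (e |: F))%N)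
          (F \in flats M).
Proof.
rewrite !inE; apply: (iffP andP) => -[FE].
  by move/forall_inP=> h; split=> // e eE eF; apply: h; rewrite inE eF.
by move=> h; split=> //; apply/forall_inP=> e; rewrite inE => /andP[eF eE]; apply: h.
Qed.

Lemma ground_flat M : ground M \in flats M.
Proof. by apply/flatsP; split=> // e ->. Qed.

Lemma flatI M A B : polymatroid M ->
  A \in flats M -> B \in flats M -> A :&: B \in flats M.
Proof.
case=> _ _ sub fA fB; have [AE hA] := flatsP _ _ fA; have [BE hB] := flatsP _ _ fB.
have main C e : C \in flats M -> A :&: B \subset C -> e \in ground M ->
    e \notin C -> (rk M (A :&: B) < rk M (e |: A :&: B))%N.
  move=> /flatsP[CE hC] sC eE eC.
  have sE : e |: A :&: B \subset ground M.
    by rewrite subUset sub1set eE (subset_trans sC).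
  have := sub C (e |: A :&: B) CE sE.
  have -> : C :|: (e |: A :&: B) = e |: C.
    by rewrite setUCA (setUidPl sC).
  have -> : C :&: (e |: A :&: B) = A :&: B.
    apply/setP=> x; rewrite !inE; apply/andP/andP=> [[xC]|[xA xB]].
      by case/orP=> [/eqP xe|/andP//]; rewrite -xe xC in eC.
    by rewrite xA xB orbT (subsetP sC) // inE xA.
  by have := hC e eE eC => h1 h2; rewrite -(ltn_add2l (rk M C));
     apply: leq_trans h2; rewrite ltn_add2r.
apply/flatsP; split=> [|e eE]; first exact: subset_trans (subsetIl _ _) AE.
rewrite inE negb_and => /orP[]; apply: main => //; [exact: subsetIl|exact: subsetIr].
Qed.

Lemma joinP M S : polymatroid M -> S \subset flats M ->
  [/\ join M S \in flats M, {in S, forall F, F \subset join M S}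
    & forall H, H \in flats M -> {in S, forall F, F \subset H} -> join M S \subset H].
Proof.
move=> pM /subsetP sS; split.
- rewrite /join (bigD1 (ground M)) /=; last first.
    rewrite ground_flat; apply/bigcupsP=> F /sS /flatsP[]//.
  set K := (X in _ :&: X).
  suff : (K == setT) || (K \in flats M).
    by case/orP=> [/eqP->|fK]; rewrite ?setIT ?flatI ?ground_flat.
  rewrite {}/K; apply: (big_ind (fun K => (K == setT) || (K \in flats M))).
  + by rewrite eqxx.
  + move=> A B /orP[/eqP->|fA] /orP[/eqP->|fB]; rewrite ?setIT ?setTI ?eqxx ?fA ?fB ?orbT //.
    by rewrite flatI ?orbT.
  + by move=> F /andP[/andP[-> _] _]; rewrite orbT.
- move=> F FS; apply/bigcapsP=> H /andP[_]; apply: subset_trans.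
  exact: (bigcup_sup F).
- move=> H fH hH; apply: (bigcap_inf H); rewrite fH; exact/bigcupsP.
Qed.

Lemma restriction_polymatroid M F :
  polymatroid M -> F \subset ground M -> polymatroid (restriction M F).
Proof.
case=> h0 hS hU FE; split=> //= A B AB BF.
  exact: hS AB (subset_trans BF FE).
by apply: hU; apply: (subset_trans _ FE).
Qed.

Lemma contraction_polymatroid M F :
  polymatroid M -> F \subset ground M -> polymatroid (contraction M F).
Proof.
case=> h0 hS hU FE; split=> /= [|A B AB BE|A B AE BE].
- by rewrite set0U subnn.
- apply: leq_sub2r; apply: hS; first exact: setSU.
  by rewrite subUset FE andbT (subset_trans BE) ?subsetDl.
have AFE : A :|: F \subset ground M by rewrite subUset FE andbT (subset_trans AE) ?subsetDl.
have BFE : B :|: F \subset ground M by rewrite subUset FE andbT (subset_trans BE) ?subsetDl.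
have := hU _ _ AFE BFE; rewrite -setUIl setUACA setUid => h.
have hF C : C :|: F \subset ground M -> (rk M F <= rk M (C :|: F))%N.
  by move=> CE; apply: hS => //; apply: subsetUr.
have := hF _ AFE; have := hF _ BFE.
have /hF : (A :|: B) :|: F \subset ground M by rewrite -(setUid F) setUACA subUset AFE.
have /hF : (A :&: B) :|: F \subset ground M by rewrite setUIl subIset ?AFE.
move=> h1 h2 h3 h4.
rewrite -(leq_add2r (rk M F + rk M F)) [in leqLHS]addnACA [in leqRHS]addnACA.
by rewrite !subnK.
Qed.

Lemma contraction_flats M F : polymatroid M -> F \in flats M ->
  flats (contraction M F) = [set H :\: F | H in interval M F (ground M)].
Proof.
case=> _ hS _ /flatsP[FE _]; apply/setP=> A.
have rkE B : B \subset ground M :\: F -> rk M (B :|: F) =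
    (rk M F + (rk M (B :|: F) - rk M F))%N.
  move=> BE; rewrite subnKC // hS ?subsetUr // subUset FE andbT.
  exact: subset_trans BE (subsetDl _ _).
apply/flatsP/imsetP=> /= [[AE hA]|[H]].
  exists (A :|: F); last first.
    by rewrite setDUl setDv setU0; apply/esym/setDidPl; case/subsetDP: AE.
  have AFE : A :|: F \subset ground M.
    by rewrite subUset FE andbT (subset_trans AE) ?subsetDl.
  rewrite inE subsetUr AFE !andbT; apply/flatsP; split=> // e eE.
  rewrite inE negb_or => /andP[eA eF]; have eEF : e \in ground M :\: F by rewrite inE eF.
  have eAE : e |: A \subset ground M :\: F by rewrite subUset sub1set eEF.
  by rewrite setUA (rkE A) // (rkE (e |: A)) // ltn_add2l hA.
rewrite inE => /andP[/flatsP[HE hH] /andP[FH _]] ->.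
have HFE : H :\: F \subset ground M :\: F by apply: setSD.
have HF : (H :\: F) :|: F = H.
  apply/setP=> x; rewrite !inE.
  by case: (boolP (x \in F)) => [/(subsetP FH)->//|_]; rewrite orbF.
split=> // e /[dup] eEF; rewrite !inE => /andP[eF eE]; rewrite eF /= => eH.
have eAE : e |: H :\: F \subset ground M :\: F by rewrite subUset sub1set eEF.
by rewrite -(ltn_add2l (rk M F)) -rkE // -rkE // -setUA HF hH.
Qed.

Lemma mobiusE P A B : mobius P A B =
  if A == B then 1
  else - \sum_(C in P | (A \subset C) && (C \proper B)) mobius P A C.
Proof.
suff recE n m (C : {set T}) : (#|C| < n)%N -> (#|C| < m)%N ->
    mobius_rec P A n C = mobius_rec P A m C.
  rewrite [LHS]/mobius /=; case: ifP => // _; congr (- _).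
  apply: eq_bigr => C /andP[_ /andP[_ /proper_card ltC]].
  exact: recE.
elim: n m C => [|n IHn] [|m] C //= ltCn ltCm; case: ifP => // _; congr (- _).
apply: eq_bigr => D /andP[_ /andP[_ /proper_card ltD]].
by apply: IHn; apply: leq_trans ltD _.
Qed.

End Polymatroids.

Arguments ground {T}.
Arguments rk {T}.

Section Dimension.
Variables (K : fieldType) (V : lmodType K).
Implicit Types (W : V -> Prop) (k : nat).

Definition basis_for W k (b : 'I_k -> V) : Prop :=
  [/\ forall i, W (b i),
      forall c : 'I_k -> K, \sum_i c i *: b i = 0 -> forall i, c i = 0
    & forall v, W v -> exists c : 'I_k -> K, v = \sum_i c i *: b i].

Definition has_dim W k : Prop := exists b : 'I_k -> V, basis_for W b.

(* Meant for finite-dimensional subspaces W; defaults to 0 otherwise. *)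
Definition dimension W : nat := classical_sets.xget 0%N (has_dim W).

Lemma has_dim_uniq W k l : has_dim W k -> has_dim W l -> k = l.
Proof.
suff le_kl (k' l' : nat) : has_dim W k' -> has_dim W l' -> (k' <= l')%N.
  by move=> hk hl; apply/eqP; rewrite eqn_leq !le_kl.
move=> [b [Wb freeb spanb]] [d [Wd _ spand]].
have /choice[f fE] i := spand _ (Wb i).
have /choice[g gE] i := spanb _ (Wd i).
pose A := \matrix_(i < k', j < l') f i j; pose B := \matrix_(i < l', j < k') g i j.
suff AB1 : A *m B = 1%:M.
  have := mxrankM_maxl A B; rewrite AB1 mxrank1 => h.
  exact: leq_trans h (rank_leq_col A).
apply/matrixP=> i j; apply/eqP; rewrite -subr_eq0; apply/eqP.
apply: (freeb (fun j => (A *m B) i j - (1%:M : 'M_k') i j)).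
under eq_bigr do rewrite scalerBl.
rewrite sumrB (bigD1 i) //= [X in _ - X](bigD1 i) //= !mxE eqxx scale1r.
rewrite [X in _ - (_ + X)]big1 ?addr0 => [|m /negPf mi]; last first.
  by rewrite mxE eq_sym mi scale0r.
apply/eqP; rewrite subr_eq0; apply/eqP.
rewrite [RHS]fE; under [RHS]eq_bigr do rewrite gE scaler_sumr.
rewrite exchange_big [RHS](bigD1 i) //=; congr (_ + _).
  by rewrite scaler_suml; apply: eq_bigr => m _; rewrite !mxE scalerA.
apply: eq_bigr => m _; rewrite mxE scaler_suml.
by apply: eq_bigr => o _; rewrite !mxE scalerA.
Qed.

Lemma has_dim_span W k (b : 'I_k -> V) : (forall i, W (b i)) ->
  (forall v, W v -> exists c : 'I_k -> K, v = \sum_i c i *: b i) ->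
  has_dim W (dimension W).
Proof.
move=> Wb sb; apply: classical_sets.xgetPex.
elim: k b Wb sb => [|k IHk] b Wb sb.
  by exists 0%N, b; split=> // c _ [].
have [freeb|] := pselect (forall c : 'I_k.+1 -> K,
    \sum_i c i *: b i = 0 -> forall i, c i = 0).
  by exists k.+1, b.
move=> /existsNP[c /not_implyP[c0 /existsNP[j /eqP cj]]].
apply: (IHk (b \o lift j)) => [i|v /sb[d ->]]; first exact: Wb.
pose e i := d (lift j i) - d j / c j * c (lift j i).
exists e; rewrite (bigD1_ord j) //= /e.
under [RHS]eq_bigr do rewrite scalerBl -scalerA.
rewrite sumrB -scaler_sumr addrC; congr (_ + _).
move: c0; rewrite (bigD1_ord j) //= addrC => /(canRL (addrK _)) ->.
by rewrite sub0r scalerN opprK scalerA divfK.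
Qed.

Lemma dimensionE W k : has_dim W k -> dimension W = k.
Proof.
by move=> hk; apply: classical_sets.xget_unique => // l hl; apply: has_dim_uniq hl hk.
Qed.

End Dimension.

Section IdealQuotient.
Variables (R : comNzRingType) (J : finType) (P : pred J) (g : J -> R).

(* The ideal generated by the g j such that P j. *)
Definition ideal_gen : {pred R} :=
  fun p => `[< exists c : J -> R, p = \sum_(j | P j) c j * g j >].

Lemma ideal_genP p :
  reflect (exists c : J -> R, p = \sum_(j | P j) c j * g j) (p \in ideal_gen).
Proof. exact: asboolP. Qed.

Lemma ideal_gen_zmod : zmod_closed ideal_gen.
Proof.
split=> [|p q /ideal_genP[c ->] /ideal_genP[d ->]]; apply/ideal_genP.
  by exists (fun=> 0); rewrite big1 // => j _; rewrite mul0r.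
exists (fun j => c j - d j); rewrite -sumrB; apply: eq_bigr => j _.
by rewrite mulrBl.
Qed.

HB.instance Definition _ := GRing.isZmodClosed.Build R ideal_gen ideal_gen_zmod.

Lemma ideal_genM a p : p \in ideal_gen -> a * p \in ideal_gen.
Proof.
move=> /ideal_genP[c ->]; apply/ideal_genP; exists (fun j => a * c j).
by rewrite mulr_sumr; apply: eq_bigr => j _; rewrite mulrA.
Qed.

Lemma mem_ideal_gen j : P j -> g j \in ideal_gen.
Proof.
move=> Pj; apply/ideal_genP; exists (fun i => (i == j)%:R).
rewrite (bigD1 j) //= eqxx mul1r big1 ?addr0 // => i /andP[_ /negPf->].
by rewrite mul0r.
Qed.

(* {ideal_quot _} is only available for proper ideals: the ring structure is
   put here on the additive quotient. *)
Definition quo : Type := Quotient.quot (ideal_gen : zmodClosed R).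
HB.instance Definition _ := Choice.on quo.
HB.instance Definition _ := GRing.Zmodule.on quo.

Definition quo_pi (p : R) : quo :=
  (\pi_(Quotient.quot (ideal_gen : zmodClosed R)) p)%qT.
Definition quo_repr (x : quo) : R :=
  (repr (x : Quotient.quot (ideal_gen : zmodClosed R)))%qT.

Lemma quo_reprK : cancel quo_repr quo_pi.
Proof. exact: reprK. Qed.

Lemma quo_piP p q : quo_pi p = quo_pi q <-> p - q \in ideal_gen.
Proof. by rewrite (Quotient.idealrBE (ideal_gen : zmodClosed R)); apply: (rwP eqP). Qed.

Lemma quo_pi0P p : quo_pi p = 0 <-> p \in ideal_gen.
Proof.
have -> : 0 = quo_pi 0 by rewrite -[RHS]/(\pi 0)%qT piE.
by rewrite quo_piP subr0.
Qed.

Lemma quo_pi_zmod_morphism : zmod_morphism quo_pi.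
Proof. by move=> p q; rewrite /quo_pi !piE. Qed.
HB.instance Definition _ :=
  GRing.isZmodMorphism.Build R quo quo_pi quo_pi_zmod_morphism.

Definition quo_mul (x y : quo) : quo := quo_pi (quo_repr x * quo_repr y).

Lemma quo_piM p q : quo_pi (p * q) = quo_mul (quo_pi p) (quo_pi q).
Proof.
apply/quo_piP; set p' := quo_repr _; set q' := quo_repr _.
have -> : p * q - p' * q' = q * (p - p') + p' * (q - q').
  by rewrite !mulrBr [q * p]mulrC [q * p']mulrC addrA subrK.
by rewrite rpredD //; apply/ideal_genM/quo_piP; rewrite quo_reprK.
Qed.

Lemma quo_mulA : associative quo_mul.
Proof.
move=> x y z; rewrite -[x]quo_reprK -[y]quo_reprK -[z]quo_reprK.
by rewrite -!quo_piM mulrA.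
Qed.

Lemma quo_mulC : commutative quo_mul.
Proof. by move=> x y; rewrite /quo_mul mulrC. Qed.

Lemma quo_mul1 : left_id (quo_pi 1) quo_mul.
Proof. by move=> x; rewrite -[x]quo_reprK -quo_piM mul1r. Qed.

Lemma quo_mulDl : left_distributive quo_mul +%R.
Proof.
move=> x y z; rewrite -[x]quo_reprK -[y]quo_reprK -[z]quo_reprK.
by rewrite -raddfD -!quo_piM mulrDl raddfD.
Qed.

HB.instance Definition _ := GRing.Zmodule_isComPzRing.Build quo
  quo_mulA quo_mulC quo_mul1 quo_mulDl.

Lemma quo_pi_monoid_morphism : monoid_morphism quo_pi.
Proof. by split=> // p q; rewrite quo_piM. Qed.
HB.instance Definition _ :=
  GRing.isMonoidMorphism.Build R quo quo_pi quo_pi_monoid_morphism.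

End IdealQuotient.

Section IdealQuotientModule.
Variables (K : comNzRingType) (R : comAlgType K).
Variables (J : finType) (P : pred J) (g : J -> R).
Local Notation D := (quo P g).
Local Notation pi := (quo_pi P g).

Definition quo_scale (a : K) (x : D) : D := pi (a *: quo_repr x).

Lemma quo_piZ a p : pi (a *: p) = quo_scale a (pi p).
Proof.
apply/quo_piP; rewrite -scalerBr -mulr_algl; apply/ideal_genM/quo_piP.
by rewrite quo_reprK.
Qed.

Lemma quo_scaleA a b x : quo_scale a (quo_scale b x) = quo_scale (a * b) x.
Proof. by rewrite -[x]quo_reprK -!quo_piZ scalerA. Qed.

Lemma quo_scale1 : left_id 1 quo_scale.
Proof. by move=> x; rewrite -[x]quo_reprK -quo_piZ scale1r. Qed.

Lemma quo_scaleDr : right_distributive quo_scale +%R.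
Proof.
move=> a x y; rewrite -[x]quo_reprK -[y]quo_reprK.
by rewrite -raddfD -!quo_piZ scalerDr raddfD.
Qed.

Lemma quo_scaleDl x : {morph quo_scale^~ x : a b / a + b}.
Proof. by move=> a b; rewrite -[x]quo_reprK -!quo_piZ scalerDl raddfD. Qed.

HB.instance Definition _ := GRing.Zmodule_isLmodule.Build K D
  quo_scaleA quo_scale1 quo_scaleDr quo_scaleDl.

Lemma quo_scaleAl (a : K) (x y : D) : a *: (x * y) = a *: x * y.
Proof.
have sE p : a *: pi p = pi (a *: p) by rewrite quo_piZ.
by rewrite -[x]quo_reprK -[y]quo_reprK -rmorphM !sE -rmorphM scalerAl.
Qed.

Lemma quo_pi_scalable : scalable pi.
Proof. exact: quo_piZ. Qed.
HB.instance Definition _ :=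
  GRing.isScalable.Build K R D *:%R pi quo_pi_scalable.

End IdealQuotientModule.

Section ChowRing.
Variables (T : finType) (M : ranked_set T) (GG : {set {set T}}).

(* The variable x_G is 'X_i for the index i of G in the enumeration of GG. *)
Local Notation R := {mpoly rat[#|GG|]}.
Local Notation flat_of i := (@enum_val _ (mem GG) i).

Definition chow_rel (S : {set {set T}}) (G : {set T}) : R :=
  (\prod_(i | flat_of i \in S) 'X_i)
    * (\sum_(i | G \subset flat_of i) 'X_i)
        ^+ (rk M G - rk M (sup_below M S G)).

Definition chow_ring : Type :=
  quo (fun SG : {set {set T}} * {set T} => (SG.1 \subset GG) && (SG.2 \in GG))
      (fun SG => chow_rel SG.1 SG.2).
HB.instance Definition _ := GRing.ComPzRing.on chow_ring.
HB.instance Definition _ := GRing.Lmodule.on chow_ring.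

Definition chow_pi : R -> chow_ring := quo_pi _ _.
HB.instance Definition _ := GRing.RMorphism.on chow_pi.
HB.instance Definition _ := GRing.Linear.on chow_pi.

Definition chow_graded (d : nat) (x : chow_ring) : Prop :=
  exists2 p : R, p \is d.-homog & x = chow_pi p.

Definition chow_dim (d : nat) : nat := dimension (chow_graded d).

(* The polynomial whose coefficients are the dimensions of the graded pieces;
   it exists by [chow_dim_eq0], see [hilbert_coef]. *)
Definition hilbert : {poly rat} :=
  classical_sets.xget 0 (fun H : {poly rat} => forall d, H`_d = (chow_dim d)%:R).

Lemma chow_has_dim d : has_dim (chow_graded d) (chow_dim d).
Proof.
pose I := 'X_{1..#|GG| < d.+1}.
pose b (m : I) := if mdeg m == d then chow_pi 'X_[m] else 0.
apply: (@has_dim_span _ _ _ _ (fun i : 'I_#|{: I}| => b (enum_val i))).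
  move=> i; rewrite /b; case: eqP => h; last by exists 0; rewrite ?dhomog0 ?raddf0.
  by exists 'X_[enum_val i] => //; rewrite dhomogX; apply/eqP.
move=> _ [p hp ->]; exists (fun i : 'I_#|{: I}| => p@_(enum_val i)).
have szp : (msize p <= d.+1)%N.
  by rewrite mmeasureE; apply/bigmax_leqP_seq => m mp _; rewrite (dhomog_mf hp).
rewrite {1}(mpolywE szp) raddf_sum /=.
rewrite (reindex (@enum_val I (mem {: I}))) /=; last first.
  by apply: onW_bij; apply: enum_val_bij.
apply: eq_bigr => i _; rewrite linearZ /= /b; case: eqP => // h.
by rewrite (dhomog_nemf_coeff hp) ?scale0r //; apply/eqP.
Qed.

Lemma chow_var_nilpotent (i : 'I_#|GG|) : exists k : nat, chow_pi 'X_i ^+ k = 0.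
Proof.
have nilD (x y : chow_ring) :
    (exists k : nat, x ^+ k = 0) -> (exists k : nat, y ^+ k = 0) ->
    exists k : nat, (x + y) ^+ k = 0.
  move=> [k xk] [l yl]; exists (k + l)%N; rewrite exprDn big1 // => j _.
  have [lej|ltj] := leqP l j; first by rewrite -(subnK lej) exprD yl !mulr0 mul0rn.
  have lek : (k <= k + l - j)%N by rewrite -addnBA ?leq_addr // ltnW.
  by rewrite -(subnK lek) exprD xk mulr0 mul0r mul0rn.
have [n] := ubnP (#|T| - #|flat_of i|); elim: n => // n IHn in i *; rewrite ltnS => lein.
pose h : R := \sum_(j | flat_of i \subset flat_of j) 'X_j.
have hnil : exists k : nat, chow_pi h ^+ k = 0.
  exists (rk M (flat_of i) - rk M (sup_below M set0 (flat_of i)))%N.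
  rewrite -rmorphXn; apply/quo_pi0P.
  have := @mem_ideal_gen R _
    (fun SG : {set {set T}} * {set T} => (SG.1 \subset GG) && (SG.2 \in GG))
    (fun SG => chow_rel SG.1 SG.2) (set0, flat_of i).
  rewrite /= sub0set enum_valP => /(_ isT).
  by rewrite /chow_rel big_pred0 ?mul1r // => j; rewrite inE.
have -> : 'X_i = h + \sum_(j | (flat_of i \subset flat_of j) && (j != i)) - 'X_j :> R.
  by rewrite /h (bigD1 i) //= sumrN addrK.
rewrite raddfD; apply: (nilD _ _) => //; rewrite raddf_sum.
apply: (big_ind (fun x : chow_ring => exists k : nat, x ^+ k = 0)).
  by exists 1%N; rewrite expr1.
  exact: nilD.
move=> j /andP[sij ji]; rewrite raddfN.
have [|k kE] := IHn j; last by exists k; rewrite exprNn kE mulr0.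
have ltij : (#|flat_of i| < #|flat_of j|)%N.
  apply: proper_card; rewrite properEneq sij andbT.
  by apply: contra ji => /eqP/enum_val_inj->.
apply: leq_trans lein; apply: ltn_sub2l => //.
exact: leq_trans ltij (max_card _).
Qed.

Lemma chow_dim_eq0 : exists N : nat, forall d, (N <= d)%N -> chow_dim d = 0%N.
Proof.
have /choice[k kE] := chow_var_nilpotent.
exists (\sum_i k i).+1 => d led.
apply: dimensionE; exists (fun=> 0); split=> [[]//|c _ []//|_ [p hp ->]].
exists (fun=> 0); rewrite big_ord0 [p]mpolyE raddf_sum /= big_seq big1 // => m mp.
rewrite linearZ /= mpolyXE_id rmorph_prod /=.
have [i lei] : exists i, (k i <= m i)%N.
  apply/existsP; apply: contraLR led => /existsPn h; rewrite -ltnNge ltnS.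
  rewrite -(dhomog_mf hp mp) /= mdegE; apply: leq_sum => i _.
  by rewrite ltnW // ltnNge h.
by rewrite (bigD1 i) //= rmorphXn -(subnK lei) exprD kE mulr0 mul0r scaler0.
Qed.

Lemma hilbert_coef d : hilbert`_d = (chow_dim d)%:R.
Proof.
move: d; apply: (@classical_sets.xgetPex _ 0
  (fun H : {poly rat} => forall d, H`_d = (chow_dim d)%:R)).
have [N hN] := chow_dim_eq0.
exists (\poly_(i < N) (chow_dim i)%:R) => d.
by rewrite coef_poly; case: ltnP => // /hN ->.
Qed.

End ChowRing.

Arguments chow_pi {T} M GG p.

(* For the empty polymatroid the only building set is empty. *)
Lemma hilbert_set0 (T : finType) (M : ranked_set T) : hilbert M set0 = 1.
Proof.
have mE (m : 'X_{1..#|@set0 {set T}|}) : m = 0%MM.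
  by apply/mnmP=> i; exfalso; move: i => [i]; rewrite cards0.
have pE (p : {mpoly rat[#|@set0 {set T}|]}) : p = (p@_0)%:MP.
  by apply/mpolyP=> m; rewrite mcoeffC (mE m) eqxx mulr1.
have pi0 p : chow_pi M set0 p = 0 -> p = 0.
  move=> /quo_pi0P/ideal_genP[c ->]; rewrite big_pred0 // => -[A B].
  by rewrite /= in_set0 andbF.
apply/polyP=> d; rewrite hilbert_coef coef1; congr (_%:R).
apply: dimensionE; exists (fun=> chow_pi M set0 1).
case: d => [|d] /=; split.
- by move=> _; exists 1; rewrite ?dhomog1.
- move=> c; rewrite big_ord1 -linearZ => /pi0 /(congr1 (mcoeff 0)).
  rewrite mcoeffZ mcoeff1 eqxx mulr1 mcoeff0 => c0 i.
  by rewrite (ord1 i).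
- move=> _ [p _ ->]; exists (fun=> p@_0); rewrite big_ord1 -linearZ /=.
  by rewrite {1}(pE p) -mul_mpolyC mulr1.
- by case.
- by move=> c _ [].
move=> _ [p hp ->]; exists (fun=> 0); rewrite big_ord0 (pE p).
have -> : p@_0 = 0 by apply: (dhomog_nemf_coeff hp); rewrite /= mdeg0.
by rewrite mpolyC0 raddf0.
Qed.

(* Main.v *)
Require Import Defs.
From HB Require Import structures.
From mathcomp Require Import all_boot all_order all_algebra fraction.
From mathcomp Require Import boolp mpoly zify ring.

Set Implicit Arguments.
Unset Strict Implicit.
Unset Printing Implicit Defensive.

Import GRing.Theory.
Local Open Scope ring_scope.

(* Write d(S, G) = rk G - rk (join of the members of S strictly below G) and
   w(b) = (x - x^b) / (1 - x), so that w(0) = -1.  The Hilbert series of the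
   Chow ring is the sum over ALL subsets S of GG, nested or not, of
   prod_(G in S) w(d(S, G)).  To see this, adjoin the variables one at a time,
   larger flats first.  If D is the ring obtained so far, x_G is the new
   variable, h is the sum of the x_H with H > G, and J is the ideal of D
   generated by the relations in which S is enlarged by G, then the new ring is
   D[x_G] / (x_G J, (x_G + h)^r); submodularity gives h^r J = 0, so it is
   additively D + sum_(1 <= k < r) x_G^k (D / J), and D / J is a ring of the
   same kind.

   For the second identity, separate in S the maximal elements U of GG from the
   others.  After clearing denominators the sum over U becomes an alternating
   sum of powers of x whose exponent does not depend on U, thanks to
   rk E = sum of the ranks of the factors and to
   sum_(F >= A) chi(M / F) = x^(rk E - rk A); hence it vanishes.

   Applied to all minors M|B / A, the second identity says that two functions
   in the incidence algebra of the lattice of flats are inverse to each other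
   on one side, hence on the other, which is the first identity. *)

(** * Monomial bases modulo homogeneous ideals *)

(** The rings met while adjoining variables are in general not Chow rings of polymatroids, so the
    induction runs over abstract exponent systems [d] with two parameters: [U] holds the variables
    adjoined so far, and [N] those that have been factored out of a relation, as happens in D / J.
    All these quotients are presented over one fixed polynomial ring, by killing the remaining
    variables.

    When r = 0 the relation (x_G + h)^r is 1 and the new ring vanishes, while h^r J = 0 forces J =
    0. The recursion D + w(r) (D / J) then reads D - D = 0, which is the origin of w(0) = -1. The
    same value makes (1 - x)(1 + w(b)) = 1 - x^b hold for every b, so that the maximal elements
    contribute a product of such factors once denominators are cleared.

    The inversion step uses the second identity for every minor at once, including the empty ones on
    the diagonal. The building axioms are therefore first put into a form that is checked to survive
    restriction and contraction. *)

Definition is_ideal (R : comNzRingType) (I : R -> Prop) : Prop :=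
  [/\ I 0, forall p q, I p -> I q -> I (p + q) & forall a p, I p -> I (a * p)].

(** Serves as the induction principle for ideal membership: inclusions are checked on generators,
    with a predicate [I] adapted to the claim. *)
Lemma ideal_gen_min (R : comNzRingType) (J : finType) (P : pred J) (g : J -> R)
    (I : R -> Prop) :
  is_ideal I -> (forall j, P j -> I (g j)) ->
  forall p, p \in ideal_gen P g -> I p.
Proof.
move=> [I0 ID IM] Ig p /ideal_genP[c ->].
by apply: (big_ind I) => // j Pj; apply/IM/Ig.
Qed.

Section MonomialBasis.
Variable n : nat.
Local Notation R := {mpoly rat[n]}.
Implicit Types (p q : R) (m : 'X_{1..n}) (B : seq 'X_{1..n}).

Lemma pihomogMr e d p q : q \is e.-homog ->
  pihomog mdeg d (p * q) = if (e <= d)%N then pihomog mdeg (d - e) p * q else 0.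
Proof.
move=> hq; elim/mpolyind: p => [|c m p _ _ IH].
  by rewrite mul0r !raddf0 mul0r if_same.
rewrite mulrDl raddfD /= {}IH -scalerAl !linearZ /= raddfD /= linearZ /=.
have hmq : 'X_[m] * q \is (mdeg m + e).-homog by rewrite dhomogM ?dhomogX.
rewrite pihomogX; case: ifP => led; last first.
  rewrite addr0 (pihomog_ne0 _ hmq) ?scaler0 //.
  by apply/eqP=> h; rewrite -h leq_addl in led.
rewrite mulrDl; congr (_ + _); case: eqP => [h|h].
  by rewrite -scalerAl pihomog_dE //; rewrite h subnK in hmq.
rewrite scaler0 mul0r (pihomog_ne0 _ hmq) ?scaler0 //.
by apply/eqP=> h'; apply: h; rewrite -h' addnK.
Qed.

Lemma mcoeff_pihomog d p m :
  (pihomog mdeg d p)@_m = if mdeg m == d then p@_m else 0.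
Proof.
elim/mpolyind: p => [|c m' p _ _ IH]; first by rewrite raddf0 mcoeff0 if_same.
rewrite raddfD /= linearZ /= !mcoeffD {}IH pihomogX !mcoeffZ mcoeffX.
have [->|mm'] := eqVneq m' m.
  by case: eqP => _; rewrite ?mcoeffX ?mcoeff0 ?eqxx ?mulr0 ?addr0.
by do 2?case: ifP => _; rewrite ?mcoeffX ?mcoeff0 ?(negPf mm') ?mulr0 ?add0r.
Qed.

Definition in_span B p := {subset msupp p <= B}.

Lemma in_span0 B : in_span B 0.
Proof. by move=> m; rewrite msupp0. Qed.

Lemma in_spanD B p q : in_span B p -> in_span B q -> in_span B (p + q).
Proof.
by move=> hp hq m /msuppD_le; rewrite mem_cat => /orP[/hp|/hq].
Qed.

Lemma in_spanZ B c p : in_span B p -> in_span B (c *: p).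
Proof. by move=> hp m /msuppZ_le /hp. Qed.

Lemma in_spanX B m : m \in B -> in_span B 'X_[m].
Proof. by move=> mB m'; rewrite msuppX inE => /eqP ->. Qed.

Lemma in_span_sum (J : Type) (r : seq J) (P : pred J) (F : J -> R) B :
  (forall j, P j -> in_span B (F j)) -> in_span B (\sum_(j <- r | P j) F j).
Proof.
by move=> h; apply: big_ind => //; [exact: in_span0|exact: in_spanD].
Qed.

Lemma in_span_subset B B' p : {subset B <= B'} -> in_span B p -> in_span B' p.
Proof. by move=> sB hp m /hp /sB. Qed.

(** Phrased with congruences rather than in a quotient ring, so that bases modulo different ideals
    of one polynomial ring can be compared and glued. *)
Definition monomial_basis (I : {pred R}) B : Prop :=
  [/\ uniq B, forall p, exists2 q, in_span B q & p - q \in I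
    & forall q, in_span B q -> q \in I -> q = 0].

Lemma monomial_basis_ext (I I' : {pred R}) B :
  I =i I' -> monomial_basis I' B -> monomial_basis I B.
Proof.
move=> eI [uB sB fB]; split=> [|p|q hq]; first exact: uB.
  by have [q hq pq] := sB p; exists q; [exact: hq|rewrite eI; exact: pq].
by rewrite eI; exact: fB hq.
Qed.

Variables (J : finType) (P : pred J) (g : J -> R).
Local Notation I := (ideal_gen P g).

Definition quo_graded (d : nat) (x : quo P g) : Prop :=
  exists2 p : R, p \is d.-homog & x = quo_pi P g p.

Hypothesis g_homog : forall j, P j -> exists e, g j \is e.-homog.

Lemma ideal_gen_pihomog d p : p \in I -> pihomog mdeg d p \in I.
Proof.
move=> /ideal_genP[c ->]; rewrite raddf_sum /= rpred_sum // => j Pj.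
have [e he] := g_homog Pj; rewrite (pihomogMr _ _ he).
by case: ifP => _; rewrite ?rpred0 // ideal_genM // mem_ideal_gen.
Qed.

(** With homogeneous generators the ideal contains the homogeneous components of its elements, so a
    class of degree [d] is already represented by the monomials of degree [d] in [B]. *)
Lemma monomial_basis_dim B d : monomial_basis I B ->
  has_dim (quo_graded d) (count (fun m => mdeg m == d) B).
Proof.
case=> uB sB fB; set Bd := [seq m <- B | mdeg m == d].
have uBd : uniq Bd by apply: filter_uniq.
rewrite -size_filter -/Bd.
pose b (i : 'I_(size Bd)) := nth 0%MM Bd i.
have bB i : b i \in Bd by apply: mem_nth.
have injb : injective b.
  by move=> i j /eqP; rewrite nth_uniq // => /eqP/val_inj.
have piE c : \sum_i c i *: quo_pi P g 'X_[b i] = quo_pi P g (\sum_i c i *: 'X_[b i]).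
  by rewrite raddf_sum; apply: eq_bigr => i _; rewrite /= linearZ.
exists (fun i => quo_pi P g 'X_[b i]); split.
- move=> i; exists 'X_[b i] => //; rewrite dhomogX /=.
  by have := bB i; rewrite mem_filter => /andP[].
- move=> c; rewrite piE => /quo_pi0P h i.
  have := fB _ _ h; set q := \sum_i _ => q0.
  have qE : q@_(b i) = c i.
    rewrite raddf_sum (bigD1 i) //= big1 => [|j ji].
      by rewrite addr0 mcoeffZ mcoeffX eqxx mulr1.
    rewrite mcoeffZ mcoeffX; case: eqP => [/injb e|]; last by rewrite mulr0.
    by rewrite e eqxx in ji.
  rewrite -qE q0 ?mcoeff0 //; apply: in_span_sum => j _; apply/in_spanZ/in_spanX.
  by have := bB j; rewrite mem_filter => /andP[].
move=> _ [p hp ->]; have [q hq pq] := sB p.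
exists (fun i => q@_(b i)); rewrite piE; apply/quo_piP.
suff -> : \sum_i q@_(b i) *: 'X_[b i] = pihomog mdeg d q.
  by rewrite -(pihomog_dE hp) -raddfB ideal_gen_pihomog.
apply/mpolyP=> m; rewrite [pihomog]lock raddf_sum /= -lock.
rewrite mcoeff_pihomog.
have [mB|mB] := boolP (m \in Bd).
  have im : (index m Bd < size Bd)%N by rewrite index_mem.
  have bm : b (Ordinal im) = m by rewrite /b /= nth_index.
  rewrite (bigD1 (Ordinal im)) //= big1 => [|j jm].
    rewrite addr0 mcoeffZ mcoeffX bm eqxx mulr1.
    by move: mB; rewrite mem_filter => /andP[->].
  rewrite mcoeffZ mcoeffX; case: eqP => [e|]; last by rewrite mulr0.
  by rewrite -bm in e; rewrite (injb _ _ e) eqxx in jm.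
rewrite big1 => [|j _].
  case: eqP => // h; rewrite memN_msupp_eq0 //; apply: contra mB => /hq mB.
  by rewrite mem_filter mB h eqxx.
rewrite mcoeffZ mcoeffX; case: eqP => [e|]; last by rewrite mulr0.
by rewrite -e bB in mB.
Qed.

End MonomialBasis.

Definition degree_gf n (B : seq 'X_{1..n}) : {poly rat} := \sum_(m <- B) 'X^(mdeg m).

Lemma coef_degree_gf n (B : seq 'X_{1..n}) d :
  (degree_gf B)`_d = (count (fun m => mdeg m == d) B)%:R.
Proof.
rewrite /degree_gf coef_sum -sum1_count natr_sum big_mkcond /= [RHS]big_mkcond /=.
by apply: eq_bigr => m _; rewrite coefXn eq_sym; case: eqP.
Qed.

(** * Adjoining one variable *)

Section SplitVariable.
Variables (n : nat) (g : 'I_n).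
Local Notation R := {mpoly rat[n]}.
Implicit Types (p q : R) (m : 'X_{1..n}) (B : seq 'X_{1..n}).

Definition mnm_drop m : 'X_{1..n} := [multinom if i == g then 0%N else m i | i < n].

Lemma mnm_dropK m : (mnm_drop m + U_(g) *+ m g)%MM = m.
Proof.
apply/mnmP=> i; rewrite mnmDE mulmnE mnm1E mnmE eq_sym.
by case: eqP => [->|]; rewrite ?mul1n ?mul0n ?add0n ?addn0.
Qed.

Lemma mnm_drop_id m : m g = 0%N -> mnm_drop m = m.
Proof. by move=> m0; apply/mnmP=> i; rewrite mnmE; case: eqP => // ->. Qed.

Lemma mnm_drop_at m : mnm_drop m g = 0%N.
Proof. by rewrite mnmE eqxx. Qed.

Lemma mnm_dropD m k : m g = 0%N -> mnm_drop (m + U_(g) *+ k)%MM = m.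
Proof.
move=> m0; apply/mnmP=> i; rewrite mnmE mnmDE mulmnE mnm1E eq_sym.
by case: eqP => [<-//|_]; rewrite mul0n addn0.
Qed.

Fact split_var_key : unit. Proof. exact: tt. Qed.
(** Regards an element of [R] as a polynomial in ['X_g] whose coefficients stay in [R] but do not
    involve ['X_g]. The equation [split_var y = y%:P] is used below to say that [y] is free of
    ['X_g]. *)
Definition split_var : R -> {poly R} := locked_with split_var_key
  (mmap (polyC \o @mpolyC n rat) (fun i => if i == g then 'X else ('X_i)%:P)).

Lemma split_var_zmod_morphism : zmod_morphism split_var.
Proof. by rewrite /split_var unlock; apply: raddfB. Qed.
HB.instance Definition _ :=
  GRing.isZmodMorphism.Build R {poly R} split_var split_var_zmod_morphism.

Lemma split_var_monoid_morphism : monoid_morphism split_var.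
Proof.
by rewrite /split_var unlock; split; [exact: rmorph1|exact: rmorphM].
Qed.
HB.instance Definition _ :=
  GRing.isMonoidMorphism.Build R {poly R} split_var split_var_monoid_morphism.

Lemma split_varXm m : split_var 'X_[m] = ('X_[mnm_drop m])%:P * 'X^(m g).
Proof.
rewrite /split_var unlock mmapX /mmap1 (bigD1 g) //= eqxx mulrC; congr (_ * _).
rewrite [in RHS]mpolyXE_id rmorph_prod [in RHS](bigD1 g) //= mnm_drop_at expr0 mul1r.
by apply: eq_bigr => i /negPf ig; rewrite ig -rmorphXn mnmE ig.
Qed.

Lemma split_varX i :
  split_var 'X_i = if i == g then 'X else ('X_i)%:P.
Proof. by rewrite /split_var unlock mmapX mmap1U. Qed.

Lemma split_varZ c p : split_var (c *: p) = (c%:MP)%:P * split_var p.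
Proof. by rewrite /split_var unlock mmapZ. Qed.

Lemma coef_split_varZ c p k : (split_var (c *: p))`_k = c *: (split_var p)`_k.
Proof. by rewrite split_varZ coefCM mul_mpolyC. Qed.

Lemma split_varK p : (split_var p).['X_g] = p.
Proof.
elim/mpolyind: p => [|c m p _ _ IH]; first by rewrite raddf0 horner0.
rewrite raddfD /= hornerD; congr (_ + _); last exact: IH.
rewrite split_varZ split_varXm !hornerM !hornerC hornerXn.
by rewrite mul_mpolyC mpolyXn -(mpolyXD _ (mnm_drop m)) mnm_dropK.
Qed.

Lemma coef_split_varXm m k :
  (split_var 'X_[m])`_k = if m g == k then 'X_[mnm_drop m] else 0.
Proof.
by rewrite split_varXm coefCM coefXn eq_sym; case: eqP; rewrite ?mulr1 ?mulr0.
Qed.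

Lemma split_var_coef p k : split_var (split_var p)`_k = ((split_var p)`_k)%:P.
Proof.
elim/mpolyind: p => [|c m p _ _ IH]; first by rewrite raddf0 coef0 raddf0.
rewrite raddfD /= coefD coef_split_varZ [in LHS]raddfD /= polyCD.
congr (_ + _); last exact: IH.
rewrite coef_split_varXm; case: ifP => _; last by rewrite scaler0 raddf0.
rewrite split_varZ split_varXm mnm_drop_at expr0 mulr1 mnm_drop_id ?mnm_drop_at //.
by rewrite -polyCM mul_mpolyC.
Qed.

Variables (A B C : {pred R}) (h : R) (r : nat) (B1 B2 : seq 'X_{1..n}).

(** [B] presents the ring D without ['X_g], [C] its quotient D / J, and [A] the new ring; [B1] and
    [B2] are bases modulo [B] and [C]. The exponents 0 < k < [r] of ['X_g] carry one copy of D / J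
    each. *)
Definition shifted_monomials := [seq (m + U_(g) *+ k)%MM | k <- iota 1 r.-1, m <- B2].

Definition step_basis := B1 ++ shifted_monomials.

Hypothesis B1g : forall m, m \in B1 -> m g = 0%N.
Hypothesis B2g : forall m, m \in B2 -> m g = 0%N.
Hypothesis r_gt0 : (0 < r)%N.

Lemma mem_step_basis m : (m \in step_basis) =
  if m g == 0%N then m \in B1 else (m g < r)%N && (mnm_drop m \in B2).
Proof.
have shP : reflect (0 < m g /\ (m g < r)%N && (mnm_drop m \in B2))%N
    (m \in shifted_monomials).
  apply: (iffP allpairsP) => [[[k m'] /= [kr m'B ->]]|[m0 /andP[mr mB]]].
    rewrite (mnm_dropD _ (B2g m'B)).
    rewrite m'B mnmDE mulmnE mnm1E eqxx B2g // mul1n add0n.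
    by move: kr; rewrite mem_iota; case: (r) r_gt0 => //= r' _; rewrite add1n andbT => /andP[-> ->].
  exists (m g, mnm_drop m); split=> //=; last by rewrite mnm_dropK.
  by rewrite mem_iota m0 add1n prednK.
rewrite mem_cat; have [m0|m0] := eqVneq (m g) 0%N.
  by rewrite orbC; case: shP => // -[]; rewrite m0.
have -> : (m \in B1) = false by apply/negP=> /B1g/eqP; apply/negP.
by apply/shP/idP => [[]//|->]; rewrite lt0n.
Qed.

Hypothesis idA : is_ideal (fun p => p \in A).
Hypothesis idB : is_ideal (fun p => p \in B).
Hypothesis idC : is_ideal (fun p => p \in C).
Hypothesis h_free : split_var h = h%:P.
Hypothesis A_split : forall p, p \in A -> exists s,
  let u := split_var p - s * ('X + h%:P) ^+ r in
  u`_0 \in B /\ forall k, u`_k.+1 \in C.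
Hypothesis B_A : forall p, p \in B -> (split_var p)`_0 \in A.
Hypothesis C_A : forall p, p \in C -> 'X_g * (split_var p)`_0 \in A.
Hypothesis hC_B : forall p, p \in C -> h ^+ r * p \in B.
Hypothesis f_A : ('X_g + h) ^+ r \in A.
Hypothesis basisB : monomial_basis B B1.
Hypothesis basisC : monomial_basis C B2.

Let AD p q : p \in A -> q \in A -> p + q \in A.
Proof. by case: idA => _ h1 _; apply: h1. Qed.
Let AM a p : p \in A -> a * p \in A.
Proof. by case: idA => _ _ h1; apply: h1. Qed.

Let Sp p := exists2 q, in_span step_basis q & p - q \in A.

Lemma step_span_add p q : Sp p -> Sp q -> Sp (p + q).
Proof.
move=> [p' hp hp'] [q' hq hq']; exists (p' + q'); first exact: in_spanD.
by rewrite opprD addrACA AD.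
Qed.

Lemma step_span_scale c p : Sp p -> Sp (c *: p).
Proof.
move=> [p' hp hp']; exists (c *: p'); first exact: in_spanZ.
by rewrite -scalerBr -mul_mpolyC AM.
Qed.

Lemma split_var_span (B0 : seq 'X_{1..n}) q :
  (forall m, m \in B0 -> m g = 0%N) -> in_span B0 q -> split_var q = q%:P.
Proof.
move=> B0g hq; rewrite [in LHS](mpolyE q) [in RHS](mpolyE q) !raddf_sum /=.
rewrite big_seq [RHS]big_seq; apply: eq_bigr => m /hq /B0g m0.
by rewrite split_varZ split_varXm m0 expr0 mulr1 mnm_drop_id // -polyCM mul_mpolyC.
Qed.

Lemma coef0_split_free y z : split_var y = y%:P -> split_var z = z%:P ->
  (split_var (y - z))`_0 = y - z.
Proof. by move=> hy hz; rewrite rmorphB /= hy hz -polyCB coefC eqxx. Qed.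

(** Strong induction on [k]: exponent 0 is reduced modulo [B], exponents strictly between 0 and [r]
    modulo [C], and from [r] on the relation [('X_g + h) ^+ r] trades the power for lower ones,
    whose new coefficients [h ^+ (r - i) * y] are again free of ['X_g]. *)
Lemma step_span_pow k y : split_var y = y%:P -> Sp ('X_g ^+ k * y).
Proof.
have [_ sB _] := basisB; have [_ sC _] := basisC.
elim/ltn_ind: k y => k IH y y_free.
have [->|k0] := eqVneq k 0%N.
  have [q hq yq] := sB y; exists q.
    move=> m /hq mB; rewrite mem_step_basis (B1g mB) eqxx //.
  rewrite expr0 mul1r; have := B_A yq.
  by rewrite (coef0_split_free y_free (split_var_span B1g hq)).
have [kr|rk] := ltnP k r.
  have [q hq yq] := sC y; exists ('X_g ^+ k * q).
    rewrite [q]mpolyE mulr_sumr big_seq; apply: in_span_sum => m mq.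
    rewrite -scalerAr; apply: in_spanZ; rewrite mpolyXn -mpolyXD addmC.
    apply: in_spanX; rewrite mem_step_basis.
    have mB := hq _ mq; rewrite mnmDE mulmnE mnm1E eqxx B2g // mul1n add0n.
    by rewrite (negPf k0) kr mnm_dropD ?B2g.
  have := C_A yq; rewrite (coef0_split_free y_free (split_var_span B2g hq)).
  move/(AM ('X_g ^+ k.-1)); rewrite mulrA -exprSr prednK ?lt0n //.
  by rewrite mulrBr.
have -> : 'X_g ^+ k * y = 'X_g ^+ (k - r) * y * ('X_g + h) ^+ r
    + \sum_(i < r) (- 'C(r, i)%:R) *: ('X_g ^+ (k - r + i) * (h ^+ (r - i) * y)).
  rewrite [in RHS](addrC 'X_g) exprDn mulr_sumr big_ord_recr /= subnn expr0 mul1r.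
  rewrite binn mulr1n mulrAC -exprD subnK // addrAC -[LHS]add0r; congr (_ + _).
  rewrite -big_split /= big1 // => i _.
  rewrite scaleNr scaler_nat exprD mulrnAr.
  by apply/eqP; rewrite subr_eq0; apply/eqP; congr (_ *+ _); ring.
apply: step_span_add.
  by exists 0; [exact: in_span0|rewrite subr0 AM].
apply: big_ind; [|exact: step_span_add|].
  by exists 0; [exact: in_span0|rewrite subr0; case: idA].
move=> i _; apply: step_span_scale; apply: IH.
  by rewrite -ltn_subRL subKn // ltn_ord.
by rewrite rmorphM rmorphXn /= h_free y_free -rmorphXn -polyCM.
Qed.

Lemma ideal_sum (I : {pred R}) (J : Type) (l : seq J) (P : pred J) (F : J -> R) :
  is_ideal (fun p => p \in I) -> (forall j, P j -> F j \in I) ->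
  \sum_(j <- l | P j) F j \in I.
Proof. by case=> I0 ID _ FI; apply: (big_ind (fun p => p \in I)). Qed.

(** [A_split] gives [split_var q = s * F + u] with [F] monic of degree [r], whereas [split_var q]
    has degree below [r]. This forces the coefficients of [s] into [C]; hence each coefficient of
    [split_var q] lies in the ideal modulo which its monomials are independent. *)
Lemma step_basis_free q : in_span step_basis q -> q \in A -> q = 0.
Proof.
move=> hq qA; have [s /= []] := A_split qA.
set F := ('X + h%:P) ^+ r; set u := _ - _ => u0 uC.
have [_ _ fB] := basisB; have [_ _ fC] := basisC.
have monF : F \is monic by rewrite /F monic_exp // -[h]opprK polyCN monicXsubC.
have szF : size F = r.+1 by rewrite /F -[h]opprK polyCN size_exp_XsubC.
have qk k : in_span (if k is 0%N then B1 else B2) (split_var q)`_k /\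
    ((r <= k)%N -> (split_var q)`_k = 0).
  rewrite (mpolyE q) raddf_sum /= coef_sum big_seq; split.
    apply: in_span_sum => m /hq; rewrite mem_step_basis coef_split_varZ => mB.
    apply: in_spanZ; rewrite coef_split_varXm.
    case: eqP => [mk|_]; last exact: in_span0.
    move: mB; rewrite mk; case: (k) mk => [/=|k'] mk => [mB|/andP[_ mB]].
      by apply: in_spanX; rewrite mnm_drop_id.
    exact: in_spanX.
  move=> rk; rewrite big1 // => m /hq; rewrite mem_step_basis coef_split_varZ.
  rewrite coef_split_varXm; have [->|_] := eqVneq (m g) k; last by rewrite scaler0.
  have -> : (k == 0%N) = false by apply/negP=> /eqP k0; move: rk; rewrite k0 leqNgt r_gt0.
  by rewrite ltnNge rk.
have [C0 CD CM] := idC; have [Bz BD BM] := idB.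
have CN p : p \in C -> - p \in C by move=> pC; rewrite -mulN1r; apply: CM.
have uE k : (split_var q)`_k = u`_k + (s * F)`_k by rewrite -coefD subrK.
(* Descending induction on [j], comparing coefficients of degree [j + r]: that of [split_var q] is
   0, that of [u] is in [C] because [j + r] is positive, and the coefficient of [s] at [j] meets the
   leading coefficient 1 of [F]. *)
have sC j : s`_j \in C.
  have [k] := ubnP (size s - j); elim: k j => // k IH j; rewrite ltnS => lek.
  have [lesj|ltjs] := leqP (size s) j; first by rewrite nth_default.
  have jr : (j < (j + r).+1)%N by rewrite ltnS leq_addr.
  have /esym := uE (j + r)%N; have [_ ->] := qk (j + r)%N; last exact: leq_addl.
  rewrite coefM (bigD1 (Ordinal jr)) //= addKn.
  have -> : F`_r = 1 by have := monicP monF; rewrite lead_coefE szF.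
  rewrite mulr1 addrCA => /eqP; rewrite addr_eq0 => /eqP ->.
  apply: CN; apply: CD.
    by have := uC (j + r).-1; rewrite prednK // addn_gt0 r_gt0 orbT.
  apply: ideal_sum => // i ij; have [ltij|leji] := ltnP i j.
    by rewrite [F`__]nth_default ?mulr0 // szF; lia.
  rewrite mulrC; apply: CM; apply: IH.
  have : (i != j :> nat) by apply: contra ij => /eqP e; apply/eqP/val_inj.
  by lia.
(* In degree 0 the product [s * F] contributes [h ^+ r] times an element of [C], which [hC_B] puts
   into [B]. *)
have qk0 k : (split_var q)`_k = 0.
  have [hk _] := qk k; case: k hk => [|k] hk.
    apply: fB => //; rewrite uE coef0M; apply: BD => //.
    rewrite mulrC -[F`_0]horner_coef0 /F horner_exp hornerD hornerX hornerC add0r.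
    exact: hC_B.
  apply: fC => //; rewrite uE; apply: CD => //; rewrite coefM.
  by apply: ideal_sum => // i _; rewrite mulrC; apply: CM.
by rewrite -(split_varK q) (_ : split_var q = 0) ?horner0 //; apply/polyP=> k; rewrite coef0.
Qed.

Lemma step_basisP : monomial_basis A step_basis.
Proof.
have [u1 _ _] := basisB; have [u2 _ _] := basisC.
split; last exact: step_basis_free.
  rewrite cat_uniq u1 /=; apply/andP; split.
    apply/hasP=> -[m ms mB1]; case/allpairsP: ms => -[k m'] /= [].
    rewrite mem_iota => /andP[k0 _] /B2g m'0 mE; have := B1g mB1.
    by rewrite mE mnmDE mulmnE mnm1E eqxx m'0 mul1n add0n => e; rewrite e in k0.
  apply: allpairs_uniq => //; first exact: iota_uniq.
  move=> [k m] [k' m'] /allpairsP[[? ?] /= [_ mB [-> ->]]].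
  case/allpairsP=> [[? ?] /= [_ mB' [-> ->]]] e.
  have eg := congr1 (fun m : 'X_{1..n} => m g) e.
  have ed := congr1 mnm_drop e.
  move: eg ed => /=; rewrite !mnmDE !mulmnE mnm1E eqxx (B2g mB) (B2g mB').
  by rewrite !mnm_dropD ?(B2g mB) ?(B2g mB') // !mul1n !add0n => -> ->.
move=> p; change (Sp p); rewrite -[p]split_varK horner_coef.
apply: big_ind; [|exact: step_span_add|].
  by exists 0; [exact: in_span0|rewrite subr0; case: idA].
by move=> k _; rewrite mulrC; apply/step_span_pow/split_var_coef.
Qed.

Lemma step_basis_gf :
  degree_gf step_basis = degree_gf B1 + (\sum_(1 <= k < r) 'X^k) * degree_gf B2.
Proof.
rewrite /degree_gf big_cat /=; congr (_ + _).
rewrite big_allpairs_dep /= mulr_suml /index_iota subn1; apply: eq_bigr => k _.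
rewrite mulr_sumr; apply: eq_bigr => m _.
by rewrite mdegD mdegMn mdeg1 mul1n exprD mulrC.
Qed.

End SplitVariable.

(** * Quotients defined by a system of exponents *)

Lemma big_subsets_setU1 (V : nmodType) (I : finType) (g : I) (U : {set I})
    (F : {set I} -> V) : g \notin U ->
  \sum_(S : {set I} | S \subset g |: U) F S =
    \sum_(S : {set I} | S \subset U) F S + \sum_(S : {set I} | S \subset U) F (g |: S).
Proof.
move=> gU; rewrite (bigID (fun S : {set I} => g \in S)) /= addrC; congr (_ + _).
  apply: eq_bigl => S; apply/andP/idP => [[SU gS]|SU].
    by rewrite -(setU1K gU) subsetD1 SU gS.
  split; first by apply: subset_trans SU (subsetUr _ _).
  by apply: contra gU => /(subsetP SU).
rewrite (reindex_onto (fun S : {set I} => g |: S) (fun S => S :\ g)) /=; last first.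
  by move=> S /andP[_ gS]; rewrite setD1K.
apply: eq_bigl => S; rewrite setU11 andbT; apply/andP/idP => [[gSU /eqP gS]|SU].
  rewrite -(setU1K gU) subsetD1 (subset_trans _ gSU) ?subsetUr //.
  by rewrite -gS !inE eqxx.
by rewrite setUS // setU1K // (contra _ gU) // => /(subsetP SU).
Qed.

Section ExponentSystem.
Variables (n : nat) (le : rel 'I_n) (d : {set 'I_n} -> 'I_n -> nat).
Local Notation R := {mpoly rat[n]}.
Local Notation lt i j := (le i j && (i != j)).
Implicit Types (S U N : {set 'I_n}) (g i j k l : 'I_n).

Definition upper_sum i : R := \sum_(j | le i j) 'X_j.

Definition exponent_rel N (S : {set 'I_n}) i : R :=
  (\prod_(j in S) 'X_j) * upper_sum i ^+ d (S :|: N) i.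

Definition partial_pred U : pred ({set 'I_n} * 'I_n + 'I_n) :=
  fun x => match x with
  | inl (A, i) => (A \subset U) && (i \in U)
  | inr i => i \notin U
  end.

Definition partial_gen N (x : {set 'I_n} * 'I_n + 'I_n) : R :=
  match x with inl (A, i) => exponent_rel N A i | inr i => 'X_i end.

(* Only the variables indexed by U survive in the quotient, and every product
   of variables is counted as if it were also divisible by those indexed by N. *)
Definition partial_ideal U N : {pred R} := ideal_gen (partial_pred U) (partial_gen N).

Hypothesis le_refl : reflexive le.
Hypothesis le_anti : antisymmetric le.
Hypothesis le_trans : transitive le.
Hypothesis d_local : forall S i, d S i = d [set j in S | lt j i] i.
Hypothesis d_anti : forall S S' i, S \subset S' -> (d S' i <= d S i)%N.
Hypothesis d_mono : forall S g k i, lt g k -> lt k i -> (d (k |: S) i <= d (g |: S) i)%N.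
Hypothesis d_submod : forall S g i, lt g i -> (d S i <= d (g |: S) i + d S g)%N.
Hypothesis d_join : forall g i k, lt g i -> lt g k -> ~~ le i k -> ~~ le k i ->
  exists l, [/\ le i l, le k l, forall m, le i m -> le k m -> le l m,
    d [set i; k] l = 0%N & forall S, (d (k |: S) l <= d (g |: S) i)%N].

Lemma partial_idealP U N : is_ideal (fun p => p \in partial_ideal U N).
Proof.
split=> [|p q|a p]; [exact: rpred0|exact: rpredD|exact: ideal_genM].
Qed.

Lemma mem_partial_ideal_rel U N S i e (a : R) : S \subset U -> i \in U ->
  (d (S :|: N) i <= e)%N ->
  a * ((\prod_(j in S) 'X_j) * upper_sum i ^+ e) \in partial_ideal U N.
Proof.
move=> SU iU led; apply: ideal_genM; rewrite -(subnK led) exprD mulrCA; apply: ideal_genM.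
by apply: (@mem_ideal_gen _ _ _ _ (inl (S, i))); rewrite /= SU.
Qed.

Lemma mem_partial_ideal_var U N i : i \notin U -> 'X_i \in partial_ideal U N.
Proof. by move=> iU; apply: (@mem_ideal_gen _ _ _ _ (inr i)). Qed.

Lemma prod_var_setU1 (k : 'I_n) S : exists a : R,
  'X_k * (\prod_(j in S) 'X_j) = a * \prod_(j in k |: S) 'X_j :> R.
Proof.
have [kS|kS] := boolP (k \in S).
  by exists 'X_k; rewrite (setUidPr _) // sub1set.
by exists 1; rewrite mul1r big_setU1.
Qed.

(** At the join [l] of [i] and [k] the exponent for [[set i; k]] is 0, and adding [N] can only lower
    it; the relation there is the bare product. *)
Lemma partial_ideal_incomparable U N g i k : (forall j, lt g j -> j \in U) ->
  lt g i -> lt g k -> ~~ le i k -> ~~ le k i -> 'X_k * 'X_i \in partial_ideal U N.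
Proof.
move=> gU gi gk ik ki; have [l [il kl _ dl _]] := d_join gi gk ik ki.
have lU : l \in U.
  apply: gU; case/andP: gi => gi /negP gni; rewrite (le_trans gi il) /=.
  apply/eqP=> gl; apply: gni; apply/eqP/le_anti; rewrite gi gl il //.
have ik' : k \notin [set i] by rewrite inE; apply/eqP=> e; rewrite e le_refl in ki.
have := @mem_partial_ideal_rel U N [set i; k] l 0 1 _ lU.
rewrite setUC expr0 mulr1 mul1r big_setU1 //= big_set1; apply.
  by rewrite subUset !sub1set !gU.
apply: leq_trans (d_anti _ (subsetUl _ _)) _.
by rewrite setUC dl.
Qed.

(** * The step from [U] to [g |: U] for [g] minimal *)

Section OneVariable.
Variables (U N : {set 'I_n}) (g : 'I_n).
Hypothesis gU : g \notin U.
Hypothesis U_up : forall i j, i \in U -> le i j -> j \in U.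
Hypothesis g_up : forall j, lt g j -> j \in U.
Hypothesis g_min : forall j, j \in U -> ~~ le j g.

Local Notation h := (\sum_(j | lt g j) 'X_j : R).
Local Notation r := (d N g).

(** For a generator [Q] at [i] above [g], multiplication by [h] agrees modulo the ideal with
    multiplication by [upper_sum i]. By [d_submod], [r] further factors [upper_sum i] make up for
    the loss of [g] in the exponent. *)
Lemma partial_ideal_annihil p :
  p \in partial_ideal U (g |: N) -> h ^+ r * p \in partial_ideal U N.
Proof.
have [I0 ID IM] := partial_idealP U N.
set I := partial_ideal U N in I0 ID IM *.
have IB p' q : p' \in I -> q \in I -> p' - q \in I by move=> *; apply: rpredB.
move: p; apply: ideal_gen_min; first split=> [|p q hp hq|a p hp].
- by rewrite mulr0.
- by rewrite mulrDr ID.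
- by rewrite mulrCA IM.
move=> [[S i]|i] /=; last by move=> iU; apply/IM/mem_partial_ideal_var.
move=> /andP[SU iU]; rewrite /exponent_rel.
have [gi|gi] := boolP (lt g i); last first.
  (* Here the exponent at [i] does not see [g], so the generator already lies in the ideal for
     [N]. *)
  apply: mem_partial_ideal_rel => //.
  rewrite [leqLHS]d_local [leqRHS]d_local.
  suff -> : [set j in S :|: (g |: N) | lt j i] = [set j in S :|: N | lt j i] by [].
  apply/setP=> j; rewrite !inE; case: (eqVneq j g) => //= ->.
  by rewrite (negPf gi) !andbF.
set a := d _ i; set Q := _ * upper_sum i ^+ a.
have aE : a = d (g |: (S :|: N)) i by rewrite /a setUCA.
(* The difference is the sum of the variables [k] above [g] but not above [i]; each of them has to
   kill [Q]. *)
have hQ : (h - upper_sum i) * Q \in I.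
  have -> : h - upper_sum i = \sum_(k | lt g k && ~~ le i k) 'X_k.
    rewrite (bigID (le i)) /= addrAC /upper_sum.
    rewrite (eq_bigl (le i)) ?subrr ?add0r // => k.
    case ik : (le i k); rewrite ?andbT ?andbF //; case/andP: gi => gi /negP gni.
    rewrite (le_trans gi ik) /=; apply/negP=> /eqP e; apply: gni.
    by apply/eqP/le_anti; rewrite gi e ik.
  rewrite mulr_suml; apply: (big_ind (fun p => p \in I)) => // k /andP[gk ik].
  have kU := g_up gk; have [b bE] := prod_var_setU1 k S.
  have kSU : k |: S \subset U by rewrite subUset sub1set kU.
  (* A variable [k] between [g] and [i] can take the place of [g] in the exponent, by [d_mono]. *)
  have [ki|ki] := boolP (le k i).
    rewrite /Q mulrA bE -mulrA; apply: mem_partial_ideal_rel => //.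
    rewrite aE -setUA; apply: d_mono => //; rewrite ki /=.
    by apply/eqP=> e; rewrite e le_refl in ik.
  (* If [k] and [i] are incomparable, multiplication by ['X_k] identifies [upper_sum i] with
     [upper_sum l]: an index above [i] but not above [l] is incomparable with [k]. The exponent [a]
     then suffices at [l], by the last clause of [d_join]. *)
  have [l [il kl lmin _ dl]] := d_join gi gk ik ki.
  have lU : l \in U by apply: U_up il.
  have hil : 'X_k * (upper_sum i - upper_sum l) \in I.
    have -> : upper_sum i - upper_sum l = \sum_(m | le i m && ~~ le l m) 'X_m.
      rewrite {1}/upper_sum (bigID (le l)) /= addrAC /upper_sum.
      rewrite (eq_bigl (le l)) ?subrr ?add0r // => m.
      by case lm : (le l m); rewrite ?andbF // andbT (le_trans il lm).
    rewrite mulr_sumr; apply: (big_ind (fun p => p \in I)) => // m /andP[im lm].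
    apply: (@partial_ideal_incomparable _ _ g) => //.
    - case/andP: gi => gi gni; rewrite (le_trans gi im) /=.
      by apply/eqP=> e; move/negP: gni; apply; apply/eqP/le_anti; rewrite gi e im.
    - by apply: contra ik => mk; apply: le_trans im mk.
    - by apply: contra lm => km; apply: lmin.
  have -> : 'X_k * Q = 'X_k * (\prod_(j in S) 'X_j) * upper_sum l ^+ a
     + (\prod_(j in S) 'X_j) * ('X_k * (upper_sum i ^+ a - upper_sum l ^+ a)).
    by rewrite /Q; ring.
  apply: ID; last first.
    by apply/IM; rewrite subrXX mulrA mulrC; apply/IM.
  rewrite bE -mulrA; apply: mem_partial_ideal_rel => //.
  by rewrite aE -setUA; apply: dl.
have -> : h ^+ r * Q = (h ^+ r - upper_sum i ^+ r) * Q + upper_sum i ^+ r * Q.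
  by rewrite mulrBl subrK.
apply: ID; first by rewrite subrXX mulrAC mulrC; apply: IM.
rewrite /Q mulrCA -exprD -[X in X \in _]mul1r; apply: mem_partial_ideal_rel => //.
rewrite addnC aE; apply: leq_trans (d_submod _ gi) _; rewrite leq_add2l.
exact/d_anti/subsetUr.
Qed.

Lemma partial_ideal_sub p : p \in partial_ideal U N -> p \in partial_ideal U (g |: N).
Proof.
move: p; apply: ideal_gen_min; first exact: partial_idealP.
move=> [[S i]|i] /=; last by apply: mem_partial_ideal_var.
case/andP=> SU iU; rewrite -[exponent_rel _ _ _]mul1r; apply: mem_partial_ideal_rel => //.
by apply/d_anti/setUS/subsetUr.
Qed.

(** No element of [U] lies below [g], so all relations at [g] share the exponent [r] and are
    multiples of one power of ['X_g + h]. *)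
Lemma d_at_min S : S \subset g |: U -> d (S :|: N) g = r.
Proof.
move=> SU; rewrite d_local [RHS]d_local; congr (d _ _); apply/setP=> j.
rewrite !inE; case jg : (lt j g); rewrite ?andbF // !andbT.
have [jS|//] := boolP (j \in S); have := subsetP SU _ jS.
case/andP: jg => jg /negPf jng; rewrite !inE jng /= => jU.
by have := g_min jU; rewrite jg.
Qed.

Lemma upper_sum_g : upper_sum g = 'X_g + h.
Proof.
by rewrite /upper_sum (bigD1 g) ?le_refl //=; congr (_ + _); apply: eq_bigl => j; rewrite eq_sym.
Qed.

Lemma split_var_prod S : g \notin S ->
  split_var g (\prod_(j in S) 'X_j) = (\prod_(j in S) 'X_j)%:P.
Proof.
move=> gS; rewrite !rmorph_prod; apply: eq_bigr => j jS /=; rewrite split_varX.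
by case: eqP => // e; rewrite -e jS in gS.
Qed.

Lemma split_var_sum (P : pred 'I_n) : ~~ P g ->
  split_var g (\sum_(j | P j) 'X_j) = (\sum_(j | P j) 'X_j)%:P.
Proof.
move=> gS; rewrite !raddf_sum; apply: eq_bigr => j jS /=; rewrite split_varX.
by case: eqP => // e; rewrite -e jS in gS.
Qed.

Lemma split_var_rel N' S i : S \subset U -> i \in U ->
  split_var g (exponent_rel N' S i) = (exponent_rel N' S i)%:P.
Proof.
move=> SU iU; rewrite /exponent_rel rmorphM rmorphXn /= split_var_prod.
  by rewrite split_var_sum ?g_min // polyCM rmorphXn.
by apply: contra gU => /(subsetP SU).
Qed.

(** A relation at [g] is a multiple of [('X + h) ^+ r]. A relation at another [i] is constant in
    ['X_g] if [g] is not in [S], and otherwise it is ['X_g] times a relation in which [g] has moved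
    to [N]. Stability under multiplication rests on [partial_ideal_sub]. *)
Lemma partial_ideal_split p : p \in partial_ideal (g |: U) N -> exists s,
  let u := split_var g p - s * ('X + h%:P) ^+ r in
  u`_0 \in partial_ideal U N /\ forall e : nat, u`_e.+1 \in partial_ideal U (g |: N).
Proof.
move: p; apply: ideal_gen_min; first split.
- exists 0; rewrite mul0r subr0 raddf0 /=; split=> [|k]; rewrite coef0; exact: rpred0.
- move=> p q [s [s0 sk]] [t [t0 tk]]; exists (s + t).
  rewrite /= rmorphD mulrDl opprD addrACA; split=> [|k]; rewrite coefD.
    exact: rpredD s0 t0.
  exact: rpredD (sk k) (tk k).
- move=> a p [s [s0 sk]]; exists (split_var g a * s).
  rewrite /= rmorphM -mulrA -mulrBr; set u := (X in _ * X).
  have uC (j : nat) : u`_j.+1 \in partial_ideal U (g |: N) := sk j.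
  split=> [|k]; first by rewrite coef0M; apply: ideal_genM.
  rewrite coefM; apply: ideal_sum; first exact: partial_idealP.
  move=> [i ik] _ /=; apply: ideal_genM; case: (k.+1 - i)%N => [|j]; last exact: uC.
  exact: partial_ideal_sub.
move=> [[S i]|i] /=; last first.
  rewrite !inE negb_or => /andP[/negPf ig iU]; exists 0; rewrite mul0r subr0 split_varX ig.
  split=> [|k]; rewrite coefC /=; [exact: mem_partial_ideal_var|exact: rpred0].
case/andP=> SU; rewrite !inE => /orP[/eqP ->|iU].
  exists (split_var g (\prod_(j in S) 'X_j)).
  rewrite /exponent_rel d_at_min // rmorphM rmorphXn /= upper_sum_g rmorphD /= split_varX eqxx.
  rewrite split_var_sum ?eqxx ?andbF // subrr.
  by split=> [|k]; rewrite coef0 rpred0.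
exists 0; rewrite mul0r subr0; have [gS|gS] := boolP (g \in S); last first.
  have SU' : S \subset U by rewrite -(setU1K gU) subsetD1 SU.
  rewrite split_var_rel //; split=> [|k]; rewrite coefC /=; last exact: rpred0.
  by rewrite -[X in X \in _]mul1r; apply: mem_partial_ideal_rel.
have SU' : S :\ g \subset U by rewrite -(setU1K gU) setSD.
have -> : exponent_rel N S i = 'X_g * exponent_rel (g |: N) (S :\ g) i.
  rewrite /exponent_rel (big_setD1 g) //= -mulrA; congr (_ * (_ * _ ^+ d _ _)).
  by rewrite setUA [_ :|: [set g]]setUC setD1K.
rewrite rmorphM /= split_varX eqxx split_var_rel //.
split=> [|k]; rewrite coefXM /=; first exact: rpred0.
rewrite coefC; case: eqP => _; last exact: rpred0.
by rewrite -[X in X \in _]mul1r; apply: mem_partial_ideal_rel.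
Qed.

Lemma partial_ideal_coef0 p : p \in partial_ideal U N ->
  (split_var g p)`_0 \in partial_ideal (g |: U) N.
Proof.
move: p; apply: ideal_gen_min; first split.
- rewrite raddf0 coef0; exact: rpred0.
- by move=> p q hp hq; rewrite rmorphD coefD rpredD.
- by move=> a p hp; rewrite rmorphM coef0M ideal_genM.
move=> [[S i]|i] /= => [/andP[SU iU]|iU].
  rewrite split_var_rel // coefC /= -[X in X \in _]mul1r; apply: mem_partial_ideal_rel => //.
    exact: subset_trans SU (subsetUr _ _).
  by rewrite inE iU orbT.
rewrite split_varX; case: ifP => ig; rewrite ?coefX ?coefC /=; first exact: rpred0.
by apply: mem_partial_ideal_var; rewrite !inE ig.
Qed.

Lemma partial_ideal_mul_coef0 p : p \in partial_ideal U (g |: N) ->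
  'X_g * (split_var g p)`_0 \in partial_ideal (g |: U) N.
Proof.
move: p; apply: ideal_gen_min; first split.
- rewrite raddf0 coef0 mulr0; exact: rpred0.
- by move=> p q hp hq; rewrite rmorphD coefD mulrDr rpredD.
- by move=> a p hp; rewrite rmorphM coef0M mulrCA ideal_genM.
move=> [[S i]|i] /= => [/andP[SU iU]|iU].
  rewrite split_var_rel // coefC /= /exponent_rel mulrA.
  have [a ->] := prod_var_setU1 g S; rewrite -mulrA; apply: mem_partial_ideal_rel => //.
  - exact: setUS.
  - by rewrite inE iU orbT.
  - by rewrite setUCA setUA.
rewrite split_varX; case: ifP => ig; rewrite ?coefX ?coefC /= ?mulr0; first exact: rpred0.
by apply: ideal_genM; apply: mem_partial_ideal_var; rewrite !inE ig.
Qed.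

Lemma partial_ideal_step (B1 B2 : seq 'X_{1..n}) : (0 < r)%N ->
  (forall m, m \in B1 -> m g = 0%N) -> (forall m, m \in B2 -> m g = 0%N) ->
  monomial_basis (partial_ideal U N) B1 ->
  monomial_basis (partial_ideal U (g |: N)) B2 ->
  monomial_basis (partial_ideal (g |: U) N) (step_basis g r B1 B2).
Proof.
move=> r0 B1g B2g b1 b2.
have h_free : split_var g h = h%:P by rewrite split_var_sum // eqxx andbF.
have f_mem : ('X_g + h) ^+ r \in partial_ideal (g |: U) N.
  rewrite -upper_sum_g.
  have := @mem_partial_ideal_rel (g |: U) N set0 g r 1 (sub0set _) (setU11 _ _).
  by rewrite set0U big_set0 !mul1r; apply.
exact: (step_basisP B1g B2g r0 (partial_idealP _ _) (partial_idealP _ _)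
  (partial_idealP _ _) h_free partial_ideal_split partial_ideal_coef0
  partial_ideal_mul_coef0 partial_ideal_annihil f_mem b1 b2).
Qed.

End OneVariable.

Definition weight (b : nat) : {poly rat} :=
  if b is 0%N then -1 else \sum_(1 <= k < b) 'X^k.

Definition weight_sum U N : {poly rat} :=
  \sum_(S : {set 'I_n} | S \subset U) \prod_(i in S) weight (d (S :|: N) i).

Lemma partial_gen_homog U N x : partial_pred U x ->
  exists e, partial_gen N x \is e.-homog.
Proof.
have hX i : ('X_i : R) \is 1.-homog by rewrite dhomogX /= mdeg1.
case: x => [[S i]|i] /= _; last by exists 1%N.
exists (#|S| + 1 * d (S :|: N) i)%N; apply: dhomogM; last first.
  by apply: dhomogMn; apply: rpred_sum.
rewrite -sum1_card; apply: (big_rec2 (fun e (p : R) => p \is e.-homog)).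
  exact: dhomog1.
by move=> j e p _ hp; apply: dhomogM.
Qed.

Lemma partial_ideal_gf_uniq U N U' N' B B' :
  partial_ideal U N =i partial_ideal U' N' ->
  monomial_basis (partial_ideal U N) B ->
  monomial_basis (partial_ideal U' N') B' -> degree_gf B = degree_gf B'.
Proof.
move=> eI bB /(monomial_basis_ext eI) bB'.
have hom := @partial_gen_homog U N.
apply/polyP=> e; rewrite !coef_degree_gf; congr (_%:R).
exact: has_dim_uniq (monomial_basis_dim hom e bB) (monomial_basis_dim hom e bB').
Qed.

(** Induction on [#|U|], removing a minimal [g]; the recursive calls have second parameter [N] and
    [g |: N], hence the generality in [N]. The vanishing of exponents outside [U] supplies [B1g] and
    [B2g] in the step. *)
Lemma partial_ideal_basis U N : (forall i j, i \in U -> le i j -> j \in U) ->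
  exists B : seq 'X_{1..n}, [/\ forall m i, m \in B -> i \notin U -> m i = 0%N,
    monomial_basis (partial_ideal U N) B & degree_gf B = weight_sum U N].
Proof.
have [k] := ubnP #|U|; elim: k U N => // k IH U N; rewrite ltnS => leUk U_up.
have [->|/set0Pn[i0 i0U]] := eqVneq U set0.
  exists [:: 0%MM]; split.
  - by move=> m i; rewrite inE => /eqP -> _; rewrite mnm0E.
  - split=> // [p|q hq].
      exists (p@_0)%:MP.
        by apply: (in_span_subset _ (B := msupp (p@_0)%:MP)) => // m; rewrite msuppC; case: ifP.
      elim/mpolyind: p => [|c m p _ _ IHp]; first by rewrite mcoeff0 subr0 rpred0.
      rewrite mcoeffD raddfD /= opprD addrACA rpredD //.
      rewrite mcoeffZ mcoeffX; have [->|/eqP m0] := eqVneq m 0%MM.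
        by rewrite mulr1 mpolyX0 -mul_mpolyC mulr1 subrr rpred0.
      rewrite mulr0 subr0 -mul_mpolyC; apply: ideal_genM.
      have [i mi] : exists i, (0 < m i)%N.
        apply/existsP; apply: contraT => /existsPn h; case: m0; apply/mnmP=> i.
        by rewrite mnm0E; apply/eqP; rewrite -leqn0 leqNgt h.
      rewrite -(submK (_ : (U_(i) <= m)%MM)) ?mpolyXD.
        by apply: ideal_genM; apply: mem_partial_ideal_var; rewrite inE.
      by apply/mnm_lepP=> j; rewrite mnm1E; case: eqP => [<-|].
    have {}hq : q = (q@_0)%:MP.
      apply/mpolyP=> m; rewrite mcoeffC; case: eqP => [<-|/eqP m0]; first by rewrite mulr1.
      rewrite mulr0 memN_msupp_eq0 //; apply: contra m0 => /hq.
      by rewrite inE eq_sym.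
    suff h0 p : p \in partial_ideal set0 N -> p@_0 = 0 by move=> /h0 q0; rewrite hq q0 mpolyC0.
    move: p; apply: ideal_gen_min; first split=> [|p p'|a p].
    + by rewrite mcoeff0.
    + by rewrite mcoeffD => -> ->; rewrite addr0.
    + by move=> p0; rewrite rmorphM /= p0 mulr0.
    + move=> [[S i]|i] /=; first by rewrite inE andbF.
      by rewrite mcoeffX => _; case: eqP => // /(congr1 mdeg); rewrite mdeg1 mdeg0.
  rewrite /degree_gf big_seq1 mdeg0 expr0 /weight_sum.
  by rewrite (big_pred1 set0) ?big_set0 // => S; rewrite subset0.
(* [above i] counts the elements of [U] below [i]; where it is smallest, the element is minimal in
   [U]. *)
pose above i := #|[set j in U | le j i]|.
have [g gU g_min] : exists2 g, g \in U & forall j, j \in U -> lt j g -> False.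
  case: (arg_minnP above i0U) => g gU' gmin; have gU : g \in U := gU'.
  exists g => // j jU /andP[jg jng].
  have := gmin _ jU; rewrite leqNgt => /negP; apply; apply: proper_card.
  apply/properP; split.
    by apply/subsetP=> i; rewrite !inE => /andP[-> ij]; apply: le_trans ij jg.
  exists g; first by rewrite !inE gU le_refl.
  rewrite !inE gU /=; apply/negP=> gj.
  by move/negP: jng; apply; apply/eqP/le_anti; rewrite jg gj.
pose U' := U :\ g; have UE : U = g |: U' by rewrite setD1K.
have gU' : g \notin U' by rewrite !inE eqxx.
have g_min' j : j \in U' -> ~~ le j g.
  by rewrite !inE => /andP[jg jU]; apply/negP=> lejg; apply: (g_min j) => //; rewrite lejg.
have U'_up i j : i \in U' -> le i j -> j \in U'.
  move=> iU' ij; have := iU'; rewrite !inE => /andP[_ iU]; rewrite (U_up _ _ iU ij) andbT.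
  by apply/eqP=> jg; have := g_min' _ iU'; rewrite -jg ij.
have g_up j : lt g j -> j \in U'.
  by case/andP=> gj gnj; rewrite !inE eq_sym gnj (U_up _ _ gU gj).
have ltU' : (#|U'| < k)%N by apply: leq_trans leUk; rewrite (cardsD1 g U) gU add1n.
have [B1 [B1U b1 w1]] := IH U' N ltU' U'_up.
have [B2 [B2U b2 w2]] := IH U' (g |: N) ltU' U'_up.
(* A subset containing [g] contributes a factor at [g] that does not depend on its other elements,
   and for these [g] acts as a member of [N]. *)
have wE : weight_sum U N = weight_sum U' N + weight (d N g) * weight_sum U' (g |: N).
  rewrite /weight_sum UE big_subsets_setU1 //; congr (_ + _).
  rewrite mulr_sumr; apply: eq_bigr => S SU'.
  rewrite big_setU1 /=; last by apply: contra gU' => /(subsetP SU').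
  rewrite (d_at_min _ g_min') ?setUS //; congr (_ * _).
  by apply: eq_bigr => i _; rewrite setUCA setUA.
rewrite {1}wE; case r0 : (d N g) => [|r'].
  (* Exponent 0 at [g] puts 1 into the ideal, so the basis is empty. Annihilation by [h ^+ 0] makes
     the ideals for [N] and [g |: N] equal, and the weight -1 cancels their equal sums. *)
  exists [::]; split=> //.
    split=> // [p|q hq].
      exists 0; first exact: in_span0.
      have := @mem_partial_ideal_rel U N set0 g 0 p (sub0set _) gU.
      by rewrite set0U big_set0 expr0 !mulr1 subr0 r0; apply.
    move=> _; apply/mpolyP=> m; rewrite mcoeff0 memN_msupp_eq0 //.
    by apply/negP=> /hq; rewrite in_nil.
  rewrite /degree_gf big_nil -w1 -w2 mulN1r; apply/esym/eqP; rewrite subr_eq0; apply/eqP.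
  apply: partial_ideal_gf_uniq b1 b2 => p; apply/idP/idP; first exact: partial_ideal_sub.
  by move=> /(partial_ideal_annihil U'_up g_up); rewrite r0 expr0 mul1r.
have rpos : (0 < d N g)%N by rewrite r0.
exists (step_basis g (d N g) B1 B2); split.
- move=> m i mB; rewrite UE !inE negb_or => /andP[ig iU'].
  move: mB; rewrite mem_step_basis //; last first.
  + by move=> m' m'B; apply: B2U.
  + by move=> m' m'B; apply: B1U.
  case: ifP => _; first by move=> mB; apply: B1U mB _; rewrite !inE.
  case/andP=> _ mB; have := B2U _ i mB; rewrite !inE => /(_ iU').
  by rewrite mnmE (negPf ig).
- rewrite UE; apply: partial_ideal_step => //.
  + by move=> m mB; apply: B1U mB _.
  + by move=> m mB; apply: B2U mB _.
by rewrite step_basis_gf w1 w2 r0.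
Qed.

End ExponentSystem.

(** * Closure in a polymatroid and building sets *)

Section Closure.
Variable T : finType.
Implicit Types (M : ranked_set T) (A B F G H K X : {set T}) (S GG : {set {set T}}).

(** Joins of flats are closures of unions ([join_cl]), so lattice computations reduce to ranks of
    plain unions. *)
Definition cl M A : {set T} := \bigcap_(F in flats M | A \subset F) F.

Lemma flat_sub M F : F \in flats M -> F \subset ground M.
Proof. by case/flatsP. Qed.

Lemma flat_rk_sub M F A : polymatroid M -> F \in flats M -> A \subset ground M ->
  (rk M (F :|: A) <= rk M F)%N -> A \subset F.
Proof.
move=> [_ mono _] /flatsP[FE hF] AE leF; apply/subsetP=> e eA; apply: contraLR leF => eF.
rewrite -ltnNge; apply: leq_trans (hF e (subsetP AE _ eA) eF) _; apply: mono.
  by rewrite setUC setUS // sub1set.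
by rewrite subUset FE.
Qed.

(** A maximal superset of [A] of the same rank is a flat, and submodularity places it inside every
    flat containing [A]. *)
Lemma clP M A : polymatroid M -> A \subset ground M ->
  [/\ cl M A \in flats M, A \subset cl M A, rk M (cl M A) = rk M A
    & forall H, H \in flats M -> A \subset H -> cl M A \subset H].
Proof.
move=> pM AE; have [_ mono submod] := pM.
pose P X := [&& A \subset X, X \subset ground M & rk M X == rk M A].
have PA : P A by rewrite /P subxx AE eqxx.
have [F /maxsetP[/and3P[AF FE /eqP rF] maxF] _] := maxset_exists PA.
have fF : F \in flats M.
  apply/flatsP; split=> // e eE eF; rewrite ltn_neqAle mono ?subsetUr ?subUset ?sub1set ?eE //.
  rewrite andbT; apply: contra eF => /eqP rE; rewrite -(maxF (e |: F)) ?setU11 ?subsetUr //.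
  by rewrite /P subUset sub1set eE FE -rE rF eqxx !andbT; apply: subset_trans AF (subsetUr _ _).
have minF H : H \in flats M -> A \subset H -> F \subset H.
  move=> fH AH; apply: (flat_rk_sub pM) => //; have HE := flat_sub fH.
  have := submod H F HE FE; have := mono A (H :&: F).
  rewrite subsetI AH AF (subset_trans (subsetIl _ _) HE) => /(_ isT isT); lia.
suff -> : cl M A = F by split.
apply/eqP; rewrite eqEsubset; apply/andP; split.
  by apply: bigcap_inf; rewrite fF.
by apply/bigcapsP=> H /andP[fH AH]; apply: minF.
Qed.

Lemma join_cl M S : join M S = cl M (cover S).
Proof. by []. Qed.

Lemma cl_id M F : F \in flats M -> cl M F = F.
Proof.
move=> fF; apply/eqP; rewrite eqEsubset; apply/andP; split.
  by apply: bigcap_inf; rewrite fF /=.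
by apply/bigcapsP=> H /andP[].
Qed.

Lemma cover2 A B : cover [set A; B] = A :|: B.
Proof.
apply/setP=> x; apply/bigcupP/setUP => [[C]|[xA|xB]].
- by rewrite !inE => /orP[/eqP->|/eqP->]; [left|right].
- by exists A; rewrite // !inE eqxx.
- by exists B; rewrite // !inE eqxx orbT.
Qed.

Lemma clS M A B : polymatroid M -> A \subset B -> B \subset ground M ->
  cl M A \subset cl M B.
Proof.
move=> pM AB BE; have [fB sB _ _] := clP pM BE.
have [_ _ _ min] := clP pM (subset_trans AB BE).
by apply: min => //; apply: subset_trans AB sB.
Qed.

Lemma cl_eq M A F : polymatroid M -> F \in flats M -> A \subset F ->
  rk M A = rk M F -> cl M A = F.
Proof.
move=> pM fF AF rAF; have FE := flat_sub fF.
have [fA sA rA min] := clP pM (subset_trans AF FE).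
have clF : cl M A \subset F by apply: min.
apply/eqP; rewrite eqEsubset clF; apply: (flat_rk_sub pM) => //.
by rewrite (setUidPr clF) rA rAF.
Qed.

Lemma cl_setUl M A B : polymatroid M -> A \subset ground M -> B \subset ground M ->
  cl M (cl M A :|: B) = cl M (A :|: B).
Proof.
move=> pM AE BE; have [fA sA _ minA] := clP pM AE.
have ABE : A :|: B \subset ground M by rewrite subUset AE.
have [fAB sAB _ _] := clP pM ABE.
have cABE : cl M A :|: B \subset ground M by rewrite subUset BE (flat_sub fA).
apply/eqP; rewrite eqEsubset; apply/andP; split; last by apply: clS => //; apply: setSU.
have [_ _ _ min] := clP pM cABE; apply: min => //; rewrite subUset.
move: sAB; rewrite subUset => /andP[sA' ->]; rewrite andbT.
exact: minA.
Qed.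

Lemma rk_cl_setU M A B : polymatroid M -> A \subset ground M -> B \subset ground M ->
  rk M (cl M A :|: B) = rk M (A :|: B).
Proof.
move=> pM AE BE; have [fA _ _ _] := clP pM AE.
have ABE : A :|: B \subset ground M by rewrite subUset AE.
have cABE : cl M A :|: B \subset ground M by rewrite subUset BE (flat_sub fA).
have [_ _ <- _] := clP pM ABE; rewrite -cl_setUl //.
by have [_ _ -> _] := clP pM cABE.
Qed.

Lemma factorsP GG G : reflect (G \in GG /\ forall H, H \in GG -> G \subset H -> H = G)
  (G \in factors GG).
Proof. by rewrite inE; apply: maxsetP. Qed.

Lemma factor_above GG G : G \in GG -> exists2 H, H \in factors GG & G \subset H.
Proof.
by move=> GGG; have [H mH GH] := @maxset_exists _ (mem GG) G GGG; exists H; rewrite ?inE.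
Qed.

(** The form of the building axioms that is carried through minors: members with a common lower
    bound in [GG] have their join in [GG], and rank is additive over factors. *)
Definition weak_building M GG : Prop :=
  [/\ GG \subset flats M :\ set0,
      forall K G H, K \in GG -> G \in GG -> H \in GG ->
        K \subset G -> K \subset H -> cl M (G :|: H) \in GG
    & forall F, F \in flats M -> rk M F = (\sum_(G in factors (below GG F)) rk M G)%N].

(** Let [F] be the join of [G] and [H]. If they lay in different factors of [F], placing [K] in
    either coordinate would give two families with join [K], against injectivity. So one factor
    contains both and equals [F]. *)
Lemma building_weak M GG : polymatroid M -> loopless M -> building_set M GG -> weak_building M GG.
Proof.
move=> pM lM [sGG bGG]; split=> // [K G H KG GGG HGG KsG KsH|F /bGG[]//].
have fl X : X \in GG -> X \in flats M /\ X != set0.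
  by move=> /(subsetP sGG); rewrite in_setD1 => /andP[].
have GHE : G :|: H \subset ground M by rewrite subUset; case: (fl _ GGG) (fl _ HGG) => /flat_sub-> _ [/flat_sub-> _].
have [fF sF _ minF] := clP pM GHE; set F := cl M _ in fF sF minF *.
move: sF; rewrite subUset => /andP[GF HF].
have Gb : G \in below GG F by rewrite inE GGG.
have Hb : H \in below GG F by rewrite inE HGG.
have [G1 fG1 GG1] := factor_above Gb; have [G2 fG2 GG2] := factor_above Hb.
have [] := factorsP _ _ fG1; rewrite inE => /andP[G1GG G1F] _.
have [fK K0] := fl _ KG; have [[inj _ _] _] := bGG F fF.
pose fam X : {ffun {set T} -> {set T}} := [ffun Y => if Y == X then K else set0].
have famP X : X \in factors (below GG F) -> K \subset X ->
    fam X \in interval_prod M (factors (below GG F)) /\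
    join_map M (factors (below GG F)) (fam X) = K.
  move=> fX KX; split.
    apply/pfamilyP; split.
      by apply/subsetP=> Y; rewrite inE ffunE; have [->//|_] := eqVneq Y X; rewrite eqxx.
    move=> Y fY; rewrite ffunE inE sub0set /=; case: eqP => [->|_]; first by rewrite fK.
    by rewrite sub0set andbT.
  rewrite /join_map join_cl -[RHS](cl_id fK); congr (cl M _).
  apply/setP=> x; apply/bigcupP/idP => [[_ /imsetP[Y _ ->]]|xK].
    by rewrite ffunE; case: eqP => // _; rewrite inE.
  by exists K => //; apply/imsetP; exists X => //; rewrite ffunE eqxx.
have [G12|G12] := eqVneq G1 G2.
  suff -> : F = G1 by [].
  apply/eqP; rewrite eqEsubset G1F andbT; apply: minF; first by case: (fl _ G1GG).
  by rewrite subUset GG1 G12.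
have [p1 j1] := famP _ fG1 (subset_trans KsG GG1).
have [p2 j2] := famP _ fG2 (subset_trans KsH GG2).
have /ffunP/(_ G1) : fam G1 = fam G2 by apply: inj => //; rewrite j1.
by rewrite !ffunE eqxx (negPf G12) => K0'; rewrite K0' eqxx in K0.
Qed.
End Closure.

(** * Families over which the rank is additive *)

Section ModularFamily.
Variables (T : finType) (M : ranked_set T).
Hypothesis pM : polymatroid M.
Implicit Types (A B F G H K X : {set T}) (s : seq {set T}) (f : {set {set T}}).

(** Shrinking the members one at a time, submodularity bounds each loss of total rank by the loss of
    that member; [X] accumulates the members already replaced. *)
Lemma rk_replace s (a : {set T} -> {set T}) X : X \subset ground M ->
  {in s, forall G, G \subset ground M} -> {in s, forall G, a G \subset G} ->
  (rk M (X :|: \bigcup_(G <- s) G) + \sum_(G <- s) rk M (a G)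
    <= rk M (X :|: \bigcup_(G <- s) a G) + \sum_(G <- s) rk M G)%N.
Proof.
have [_ mono submod] := pM.
elim: s X => [|G s IH] X XE sE aG; first by rewrite !big_nil.
rewrite !big_cons.
have GE : G \subset ground M by apply: sE; rewrite mem_head.
have aGG : a G \subset G by apply: aG; rewrite mem_head.
have sE' : {in s, forall G, G \subset ground M} by move=> K Ks; apply: sE; rewrite inE Ks orbT.
have aG' : {in s, forall G, a G \subset G} by move=> K Ks; apply: aG; rewrite inE Ks orbT.
have uE : \bigcup_(K <- s) K \subset ground M.
  by rewrite big_seq; apply: (big_ind (fun K => K \subset ground M)) => //;
    [exact: sub0set|move=> A B; rewrite subUset => -> ->].
have aGE := subset_trans aGG GE.
have XaE : X :|: a G \subset ground M by rewrite subUset XE.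
have := IH _ XaE sE' aG'.
have YE : (X :|: a G) :|: \bigcup_(K <- s) K \subset ground M by rewrite subUset XaE.
have := submod _ _ YE GE.
have -> : (X :|: a G :|: \bigcup_(K <- s) K) :|: G = X :|: (G :|: \bigcup_(K <- s) K).
  rewrite -!setUA; congr (_ :|: _); rewrite [_ :|: G]setUC setUA.
  by rewrite (setUidPr aGG).
have : (rk M (a G) <= rk M ((X :|: a G :|: \bigcup_(K <- s) K) :&: G))%N.
  apply: mono; last by apply: subset_trans (subsetIr _ _) GE.
  by rewrite subsetI aGG andbT -setUA subsetU // subsetUl orbT.
rewrite -!setUA; lia.
Qed.

Lemma rk_bigcup_le f (a : {set T} -> {set T}) :
  {in f, forall G, a G \subset ground M} ->
  (rk M (\bigcup_(G in f) a G) <= \sum_(G in f) rk M (a G))%N.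
Proof.
have [rk0 mono submod] := pM => aE.
suff [] : (\bigcup_(G in f) a G \subset ground M) /\
  (rk M (\bigcup_(G in f) a G) <= \sum_(G in f) rk M (a G))%N by [].
apply: (big_rec2 (fun A (k : nat) => (A \subset ground M) /\ (rk M A <= k)%N)).
  by rewrite rk0 sub0set.
move=> G k A /aE GE [AE leA]; rewrite subUset GE AE; split=> //.
by have := submod _ _ GE AE; lia.
Qed.

(** Subadditivity gives one inequality. Starting from equality for the full family, [rk_replace]
    gives the other. *)
Lemma modular_family f (a : {set T} -> {set T}) :
  {in f, forall G, G \subset ground M} -> {in f, forall G, a G \subset G} ->
  rk M (cover f) = (\sum_(G in f) rk M G)%N ->
  rk M (\bigcup_(G in f) a G) = (\sum_(G in f) rk M (a G))%N.
Proof.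
move=> fE aG modf; apply/eqP; rewrite eqn_leq rk_bigcup_le /=; last first.
  by move=> G fG; apply: subset_trans (aG _ fG) (fE _ fG).
have := @rk_replace (enum f) a set0 (sub0set _).
rewrite !set0U !big_enum /=.
rewrite -/(cover f) modf addnC leq_add2r; apply=> G; rewrite mem_enum.
  exact: fE.
exact: aG.
Qed.

End ModularFamily.

(** * Factors of flats and their behaviour under contraction *)

Section WeakBuilding.
Variables (T : finType) (M : ranked_set T) (GG : {set {set T}}).
Hypothesis pM : polymatroid M.
Hypothesis wG : weak_building M GG.
Implicit Types (A B D F G H K L X : {set T}).

Lemma wb_flat G : G \in GG -> G \in flats M.
Proof. by case: wG => /subsetP s _ _ /s; rewrite in_setD1 => /andP[]. Qed.

Lemma wb_neq0 G : G \in GG -> G != set0.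
Proof. by case: wG => /subsetP s _ _ /s; rewrite in_setD1 => /andP[]. Qed.

Lemma wb_sub G : G \in GG -> G \subset ground M.
Proof. by move/wb_flat/flat_sub. Qed.

Lemma mem_factor_below H G : G \in factors (below GG H) -> G \in GG /\ G \subset H.
Proof. by case/factorsP; rewrite inE => /andP[]. Qed.

Lemma below_ground : below GG (ground M) = GG.
Proof.
by apply/setP=> G; rewrite inE; case: (boolP (G \in GG)) => // /wb_sub ->.
Qed.

Section InFlat.
Variable D : {set T}.
Hypothesis fD : D \in flats M.
Local Notation f := (factors (below GG D)).

Lemma factor_uniq K G H : K \in GG -> G \in f -> H \in f ->
  K \subset G -> K \subset H -> G = H.
Proof.
have [_ w1 _] := wG => KGG fG fH KG KH.
have [GGG GD] := mem_factor_below fG; have [HGG HD] := mem_factor_below fH.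
have GHE : G :|: H \subset ground M by rewrite subUset !wb_sub.
have [fL] := clP pM GHE; rewrite subUset => /andP[GL HL] _ minL.
have LD : cl M (G :|: H) \subset D by apply: minL => //; rewrite subUset GD.
have LGG := w1 _ _ _ KGG GGG HGG KG KH.
have Lb : cl M (G :|: H) \in below GG D by rewrite inE LGG.
have [_ mG] := factorsP _ _ fG; have [_ mH] := factorsP _ _ fH.
by rewrite -(mG _ Lb GL) (mH _ Lb HL).
Qed.

Lemma cover_factors_sub : cover f \subset D.
Proof. by apply/bigcupsP=> G /mem_factor_below[]. Qed.

(** [D] and the closure of the union of its factors contain the same members of [GG], hence have the
    same factors and the same rank. *)
Lemma rk_cover_factors : rk M (cover f) = rk M D.
Proof.
have [_ _ w2] := wG; have cE := subset_trans cover_factors_sub (flat_sub fD).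
have [fC sC rC minC] := clP pM cE; rewrite -rC !w2 //.
have -> // : below GG (cl M (cover f)) = below GG D.
apply/setP=> G; rewrite !inE; case GGG : (G \in GG) => //=; apply/idP/idP => [GC|GD].
  by apply: subset_trans GC _; apply: minC => //; apply: cover_factors_sub.
have Gb : G \in below GG D by rewrite inE GGG.
have [H fH GH] := factor_above Gb; apply: subset_trans GH (subset_trans _ sC).
exact: bigcup_sup.
Qed.

Lemma modular_factors (a : {set T} -> {set T}) : {in f, forall G, a G \subset G} ->
  rk M (\bigcup_(G in f) a G) = (\sum_(G in f) rk M (a G))%N.
Proof.
have [_ _ w2] := wG => aG; apply: modular_family => //; last by rewrite rk_cover_factors w2.
by move=> G /mem_factor_below[/wb_sub].
Qed.

End InFlat.

Lemma cl_cover_below F : F \in flats M -> cl M (cover (below GG F)) = F.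
Proof.
move=> fF; have sF : cover (below GG F) \subset F by apply/bigcupsP=> G; rewrite inE => /andP[].
apply: cl_eq => //; have [_ mono _] := pM; have FE := flat_sub fF.
apply/eqP; rewrite eqn_leq mono //= -{1}(rk_cover_factors fF); apply: mono.
  apply/bigcupsP=> G /factorsP[Gb _]; exact: bigcup_sup.
exact: subset_trans sF FE.
Qed.

(** When [F] and [G] are flats, the closure of this union is [F :&: G], the component of [F] in the
    factor [G]. The union itself is enough for rank computations. *)
Definition part F G : {set T} := cover [set L in GG | (L \subset F) && (L \subset G)].

Lemma part_sub F G : part F G \subset G.
Proof. by apply/bigcupsP=> L; rewrite inE => /and3P[]. Qed.

Lemma part_subl F G : part F G \subset F.
Proof. by apply/bigcupsP=> L; rewrite inE => /and3P[]. Qed.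

Section Contraction.
Variables (F D : {set T}).
Hypotheses (fF : F \in flats M) (fD : D \in flats M) (FD : F \subset D).
Local Notation f := (factors (below GG D)).

Lemma cover_parts : \bigcup_(G in f) part F G = cover (below GG F).
Proof.
apply/setP=> x; apply/bigcupP/bigcupP => [[G fG /bigcupP[L]]|[L]].
  by rewrite inE => /and3P[LGG LF LG] xL; exists L => //; rewrite inE LGG.
rewrite inE => /andP[LGG LF] xL.
have Lb : L \in below GG D by rewrite inE LGG (subset_trans LF).
have [G fG LG] := factor_above Lb; exists G => //; apply/bigcupP; exists L => //.
by rewrite inE LGG LF.
Qed.

Lemma rk_flat_parts : rk M F = (\sum_(G in f) rk M (part F G))%N.
Proof.
have sE : cover (below GG F) \subset ground M.
  by apply/bigcupsP=> G; rewrite inE => /andP[/wb_sub].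
rewrite -modular_factors // => [|G _]; last exact: part_sub.
by rewrite cover_parts; have [_ _ <- _] := clP pM sE; rewrite cl_cover_below.
Qed.

Lemma rk_factorU_flat G K : G \in f -> K \subset G ->
  rk M (K :|: F) = (rk M (K :|: part F G) + \sum_(H in f | H != G) rk M (part F H))%N.
Proof.
move=> fG KG; have [GGG _] := mem_factor_below fG; have GE := wb_sub GGG.
have KE := subset_trans KG GE.
have sE : cover (below GG F) \subset ground M.
  by apply/bigcupsP=> L; rewrite inE => /andP[/wb_sub].
rewrite setUC -{1}(cl_cover_below fF) rk_cl_setU // -cover_parts.
pose a H := if H == G then K :|: part F G else part F H.
have -> : \bigcup_(H in f) part F H :|: K = \bigcup_(H in f) a H.
  rewrite (bigD1 G) //= [RHS](bigD1 G) //= {1}/a eqxx setUC setUA; congr (_ :|: _).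
  by apply: eq_bigr => H /andP[_ /negPf HG]; rewrite /a HG.
rewrite modular_factors // => [|H fH].
  rewrite (bigD1 G) //= /a eqxx; congr (_ + _)%N.
  by apply: eq_bigr => H /andP[_ /negPf HG]; rewrite HG.
by rewrite /a; case: eqP => [->|_]; rewrite ?subUset ?KG part_sub.
Qed.

(** [K] lies in some factor [H] of [D]. If [H] differs from [G], rank splits over the factors, so
    adding [K] to [G :|: F] without gain of rank means no gain over [part F H] either; then [K] lies
    in the closure of [part F H], hence in [F]. *)
Lemma contr_sub_factor G K : G \in f -> K \in GG -> ~~ (K \subset F) ->
  K \subset cl M (G :|: F) -> K \subset G.
Proof.
move=> fG KGG KF Kcl; have [GGG GD] := mem_factor_below fG.
have GE := wb_sub GGG; have KE := wb_sub KGG; have FE := flat_sub fF.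
have GFE : G :|: F \subset ground M by rewrite subUset GE.
have [fC sC rC minC] := clP pM GFE.
have KD : K \subset D by apply: subset_trans Kcl _; apply: minC; rewrite // subUset GD.
have Kb : K \in below GG D by rewrite inE KGG.
have [H fH KH] := factor_above Kb; have [<-//|GH] := eqVneq H G.
have [HGG _] := mem_factor_below fH; have HE := wb_sub HGG.
case/negP: KF; have PE : part F H \subset ground M by apply: subset_trans (part_sub _ _) HE.
have [fP sP rP minP] := clP pM PE.
apply: subset_trans (minP _ fF (part_subl _ _)).
apply: (flat_rk_sub pM) => //; rewrite rk_cl_setU // rP.
have : rk M (G :|: F :|: K) = rk M (G :|: F).
  by rewrite -rk_cl_setU // (setUidPl Kcl) rC.
have sE : cover (below GG F) \subset ground M.
  by apply/bigcupsP=> L; rewrite inE => /andP[/wb_sub].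
have rU X : X \subset ground M -> rk M (F :|: X) = rk M (cover (below GG F) :|: X).
  by move=> XE; rewrite -{1}(cl_cover_below fF) rk_cl_setU.
rewrite [G :|: F]setUC -setUA !rU // ?subUset ?GE //.
pose a X L := if L == G then G else if L == H then part F H :|: X else part F L.
have aE X : X \subset H -> cover (below GG F) :|: (G :|: X) = \bigcup_(L in f) a X L.
  move=> XH; apply/eqP; rewrite -cover_parts eqEsubset !subUset -!andbA; apply/and4P; split.
  - apply/bigcupsP=> L fL; apply: subset_trans (bigcup_sup L fL); rewrite /a.
    case: eqP => [->|_]; first exact: part_sub.
    by case: eqP => [->|_] //; apply: subsetUl.
  - by apply: subset_trans (bigcup_sup G fG); rewrite /a eqxx.
  - by apply: subset_trans (bigcup_sup H fH); rewrite /a (negPf GH) eqxx subsetUr.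
  apply/bigcupsP=> L fL; rewrite /a; case: eqP => [_|_].
    by rewrite setUCA subsetUl.
  have sL : part F L \subset \bigcup_(L in f) part F L := bigcup_sup L fL.
  case: eqP sL => [->|_] sL; last by apply: subset_trans sL (subsetUl _ _).
  by rewrite setUA subUset subsetUr andbT -setUA; apply: subset_trans sL (subsetUl _ _).
have rkE X : X \subset H -> rk M (cover (below GG F) :|: (G :|: X)) =
    (rk M G + (rk M (part F H :|: X) + \sum_(L in f | (L != G) && (L != H)) rk M (part F L)))%N.
  move=> XH; rewrite aE // modular_factors // => [|L _]; last first.
    by rewrite /a; do 2!case: eqP => [->|_] //; rewrite ?subUset ?XH part_sub.
  rewrite (bigD1 G) //= {1}/a eqxx (bigD1 H) ?fH //= {1}/a eqxx (negPf GH).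
  congr (_ + (_ + _))%N; rewrite (eq_bigl (fun L => (L \in f) && ((L != G) && (L != H)))).
    by apply: eq_bigr => L /andP[_ /andP[/negPf LG /negPf LH]]; rewrite /a LG LH.
  by move=> L; rewrite andbA.
have := rkE set0 (sub0set _); rewrite !setU0 => ->; rewrite rkE //.
by move/eqP; rewrite eqn_add2l eqn_add2r => /eqP ->.
Qed.

Definition contr_flat G : {set T} := cl M (G :|: F) :\: F.

Lemma contr_flat_subE G H : G \in GG -> H \in GG ->
  (contr_flat G \subset contr_flat H) = (G \subset cl M (H :|: F)).
Proof.
move=> GGG HGG; have FE := flat_sub fF.
have GFE : G :|: F \subset ground M by rewrite subUset wb_sub.
have HFE : H :|: F \subset ground M by rewrite subUset wb_sub.
have [fC sC _ minC] := clP pM GFE; have [fH' sH' _ _] := clP pM HFE.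
move: sC sH'; rewrite !subUset => /andP[GC FC] /andP[HH' FH'].
apply/idP/idP => [sub|GH].
  apply/subsetP=> x xG; have [xF|xF] := boolP (x \in F); first exact: (subsetP FH').
  have : x \in contr_flat G by rewrite inE xF (subsetP GC).
  by move/(subsetP sub); rewrite inE => /andP[].
by apply: setSD; apply: minC; rewrite // subUset GH.
Qed.

(** By [contr_sub_factor], inclusion of images under [contr_flat] reflects inclusion in a factor, so
    distinct factors outside [F] stay distinct and maximal. *)
Lemma factors_contr :
  factors [set contr_flat G | G in below GG D & ~~ (G \subset F)] =
    [set contr_flat G | G in f & ~~ (G \subset F)] /\
  {in [set G in f | ~~ (G \subset F)] &, injective contr_flat}.
Proof.
have subC G H : G \in GG -> H \in GG -> G \subset H -> contr_flat G \subset contr_flat H.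
  move=> GGG HGG GH; rewrite contr_flat_subE //; apply: subset_trans GH _.
  have HFE : H :|: F \subset ground M by rewrite subUset wb_sub // flat_sub.
  by have [_] := clP pM HFE; rewrite subUset => /andP[].
have key G H : G \in GG -> ~~ (G \subset F) -> H \in f ->
    contr_flat G \subset contr_flat H -> G \subset H.
  move=> GGG GF fH; have [HGG _] := mem_factor_below fH.
  by rewrite contr_flat_subE //; apply: contr_sub_factor.
have key2 G H : G \in f -> ~~ (G \subset F) -> H \in f ->
    contr_flat G \subset contr_flat H -> G = H.
  move=> fG GF fH GH; have [GGG _] := mem_factor_below fG.
  by apply: (factor_uniq fD GGG) => //; apply: key.
split; last first.
  move=> G H; rewrite !inE => /andP[fG GF] /andP[fH _] e; apply: key2 => //; rewrite ?e //.
  + by rewrite inE.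
  + by rewrite inE.
apply/setP=> X; apply/factorsP/imsetP => [[/imsetP[G]]|[G]].
  rewrite inE => /andP[Gb GF] -> max; have [H fH GH] := factor_above Gb.
  have HF : ~~ (H \subset F) by apply: contra GF => /(subset_trans GH).
  have [HGG HD] := mem_factor_below fH.
  exists H; first by rewrite inE fH.
  apply/esym/max; last by apply: subC => //; move: Gb; rewrite inE => /andP[].
  by apply/imsetP; exists H => //; rewrite !inE HGG HD.
rewrite inE => /andP[fG GF] ->; have [GGG GD] := mem_factor_below fG; split.
  by apply/imsetP; exists G => //; rewrite !inE GGG GD.
move=> _ /imsetP[K + ->] GK; rewrite inE => /andP[Kb KF].
have KGG : K \in GG by move: Kb; rewrite inE => /andP[].
have [H fH KH] := factor_above Kb; have [HGG HD] := mem_factor_below fH.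
have HK := subC _ _ KGG HGG KH.
have GH := key2 _ _ fG GF fH (subset_trans GK HK).
by apply/eqP; rewrite eqEsubset GK GH HK.
Qed.

End Contraction.
End WeakBuilding.

(** * Minors *)

Section Minors.
Variable T : finType.
Implicit Types (M : ranked_set T) (A B D F G H K X : {set T}) (GG : {set {set T}}).

Lemma cl_unique M A F : polymatroid M -> F \in flats M -> A \subset F ->
  (forall H, H \in flats M -> A \subset H -> F \subset H) -> cl M A = F.
Proof.
move=> pM fF AF min; have [fA sA _ minA] := clP pM (subset_trans AF (flat_sub fF)).
by apply/eqP; rewrite eqEsubset minA // min.
Qed.

Lemma flats_restr M F H : polymatroid M -> F \in flats M ->
  (H \in flats (restriction M F)) = (H \in flats M) && (H \subset F).
Proof.
move=> pM fF; have FE := flat_sub fF.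
apply/flatsP/andP => /= [[HF hH]|[/flatsP[HE hH] HF]]; last first.
  by split=> // e eF; apply: hH; apply: (subsetP FE).
split=> //; have HE := subset_trans HF FE; apply/flatsP; split=> // e eE eH.
have [eF|eF] := boolP (e \in F); first exact: hH.
have [fC sC rC minC] := clP pM HE; rewrite ltnNge; apply: contra eF => le.
apply: (subsetP (minC _ fF HF)); rewrite -sub1set; apply: (flat_rk_sub pM) => //.
  by rewrite sub1set.
by rewrite rk_cl_setU ?sub1set // rC setUC.
Qed.

Lemma cl_restr M F A : polymatroid M -> F \in flats M -> A \subset F ->
  cl (restriction M F) A = cl M A.
Proof.
move=> pM fF AF; have FE := flat_sub fF; have AE := subset_trans AF FE.
have [fC sC _ minC] := clP pM AE.
apply: cl_unique => //; first exact: restriction_polymatroid.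
  by rewrite flats_restr // fC minC.
by move=> H; rewrite flats_restr // => /andP[fH _]; apply: minC.
Qed.

Lemma below_below GG F H : H \subset F -> below (below GG F) H = below GG H.
Proof.
move=> HF; apply/setP=> G; rewrite !inE; case: (G \in GG) => //=.
by case: (boolP (G \subset H)) => [GH|]; rewrite ?andbT ?andbF // (subset_trans GH).
Qed.

Lemma weak_building_restr M GG F : polymatroid M -> F \in flats M ->
  weak_building M GG -> weak_building (restriction M F) (building_restr GG F).
Proof.
move=> pM fF wG; have [_ w1 w2] := wG; split=> [|K G H|H].
- apply/subsetP=> G; rewrite inE => /andP[GGG GF].
  by rewrite in_setD1 flats_restr // (wb_neq0 wG GGG) (wb_flat wG GGG) GF.
- rewrite !inE => /andP[KGG KF] /andP[GGG GF] /andP[HGG HF] KG KH.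
  rewrite cl_restr ?subUset ?GF // (w1 K) //=.
  have GHE : G :|: H \subset ground M by rewrite subUset !(wb_sub wG).
  by have [_ _ _ min] := clP pM GHE; apply: min; rewrite // subUset GF.
by rewrite flats_restr // => /andP[fH HF]; rewrite /building_restr below_below // w2.
Qed.

Lemma restriction_ground M : restriction M (ground M) = M.
Proof. by case: M. Qed.

Lemma contraction_set0 M : rk M set0 = 0%N -> contraction M set0 = M.
Proof.
case: M => E r /= r0; congr RankedSet; first exact: setD0.
by apply: funext => A /=; rewrite r0 subn0 setU0.
Qed.

Lemma contraction_contraction M A B : polymatroid M -> A \subset B -> B \subset ground M ->
  contraction (contraction M A) (B :\: A) = contraction M B.
Proof.
move=> [_ mono _] AB BE; have BA : B :\: A :|: A = B.
  by rewrite setUC -[in RHS](setID B A) (setIidPr AB).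
congr RankedSet => /=.
  apply/setP=> x; rewrite !inE; have := subsetP AB x.
  by case: (x \in A); case: (x \in B); case: (x \in ground M) => //= /(_ isT).
apply: funext => X; rewrite -setUA BA; have := mono A B AB BE; lia.
Qed.

Section Contract.
Variables (M : ranked_set T) (GG : {set {set T}}) (F : {set T}).
Hypotheses (pM : polymatroid M) (fF : F \in flats M).

Let FE := flat_sub fF.

Lemma setDUK D : F \subset D -> D :\: F :|: F = D.
Proof. by move=> FD; rewrite setUC -[in RHS](setID D F) (setIidPr FD). Qed.

Lemma contr_flatsP H :
  reflect (exists D, [/\ D \in flats M, F \subset D & H = D :\: F])
          (H \in flats (contraction M F)).
Proof.
rewrite contraction_flats //; apply: (iffP imsetP) => [[D]|[D [fD FD ->]]].
  by rewrite inE => /and3P[fD FD _] ->; exists D.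
by exists D => //; rewrite inE fD FD flat_sub.
Qed.

Lemma setD_flat D : D \in flats M -> F \subset D -> D :\: F \in flats (contraction M F).
Proof. by move=> fD FD; apply/contr_flatsP; exists D. Qed.

Lemma cl_contr A : A \subset ground M :\: F ->
  cl (contraction M F) A = cl M (A :|: F) :\: F.
Proof.
move=> /subsetDP[AE AF].
have AFE : A :|: F \subset ground M by rewrite subUset AE.
have [fC sC _ minC] := clP pM AFE; have := sC; rewrite subUset => /andP[sA sF].
apply: cl_unique; [exact: contraction_polymatroid|exact: setD_flat| |].
  by rewrite subsetD sA.
move=> _ /contr_flatsP[D [fD FD ->]]; rewrite subsetD => /andP[AD _].
by apply: setSD; apply: minC; rewrite // subUset AD.
Qed.

Lemma building_contrE :
  building_contr M GG F = [set contr_flat M F G | G in GG & ~~ (G \subset F)].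
Proof. by apply: eq_imset => G; rewrite join_cl cover2. Qed.

Lemma contraction_loopless : loopless (contraction M F).
Proof. by rewrite /loopless -(setDv F) setD_flat. Qed.

Hypothesis wG : weak_building M GG.

Lemma contr_flat_subD G D : G \in GG -> D \in flats M -> F \subset D ->
  (contr_flat M F G \subset D :\: F) = (G \subset D).
Proof.
move=> GGG fD FD; have GFE : G :|: F \subset ground M by rewrite subUset (wb_sub wG).
have [fC sC _ minC] := clP pM GFE; move: sC; rewrite subUset => /andP[GC FC].
apply/idP/idP => [sub|GD]; last by apply: setSD; apply: minC; rewrite // subUset GD.
apply/subsetP=> x xG; have [xF|xF] := boolP (x \in F); first exact: (subsetP FD).
have : x \in contr_flat M F G by rewrite inE xF (subsetP GC).
by move/(subsetP sub); rewrite inE => /andP[].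
Qed.

Lemma below_contr D : D \in flats M -> F \subset D ->
  below (building_contr M GG F) (D :\: F) =
    [set contr_flat M F G | G in below GG D & ~~ (G \subset F)].
Proof.
move=> fD FD; rewrite building_contrE; apply/setP=> X; rewrite inE.
apply/andP/imsetP => [[/imsetP[G]]|[G]].
  rewrite !inE => /andP[GGG GF] ->; rewrite contr_flat_subD // => GD.
  by exists G => //; rewrite !inE GGG GD.
rewrite !inE -andbA => /and3P[GGG GD GF] ->; rewrite contr_flat_subD //; split=> //.
by apply/imsetP; exists G => //; rewrite inE GGG.
Qed.

Lemma card_factors_contr :
  #|factors (building_contr M GG F)| = #|[set G in factors GG | ~~ (G \subset F)]|.
Proof.
have [fE inj] := factors_contr pM wG fF (ground_flat M) FE.
rewrite (below_ground wG) in fE inj.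
by rewrite building_contrE fE card_in_imset.
Qed.

(** For joins, the three members are lifted to members of [GG] that really share a lower bound. For
    ranks, each factor loses the rank of its component of [F]. *)
Lemma weak_building_contr : weak_building (contraction M F) (building_contr M GG F).
Proof.
have [_ w1 w2] := wG; have [_ mono _] := pM.
have clGF G : G \in GG -> [/\ cl M (G :|: F) \in flats M, G \subset cl M (G :|: F)
    & F \subset cl M (G :|: F)].
  move=> GGG; have GFE : G :|: F \subset ground M by rewrite subUset (wb_sub wG).
  by have [fC sC _ _] := clP pM GFE; move: sC; rewrite subUset => /andP[].
split.
- apply/subsetP=> X; rewrite building_contrE => /imsetP[G]; rewrite inE => /andP[GGG GF] ->.
  have [fC GC FC] := clGF _ GGG; rewrite in_setD1 setD_flat // andbT.
  by rewrite setD_eq0; apply: contra GF; apply: subset_trans.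
- rewrite building_contrE => _ _ _ /imsetP[K + ->] /imsetP[G + ->] /imsetP[H + ->].
  rewrite !inE => /andP[KGG KF] /andP[GGG GF] /andP[HGG HF].
  (* [K] lies below [X] only modulo [F]. The factor [Y] of [cl M (X :|: F)] that contains [X] also
     contains [K], by [contr_sub_factor], and has the same closure with [F] as [X]. *)
  have hat X : X \in GG -> contr_flat M F K \subset contr_flat M F X ->
      exists Y, [/\ Y \in GG, K \subset Y, X \subset Y & Y \subset cl M (X :|: F)].
    move=> XGG; rewrite (contr_flat_subE pM wG fF KGG XGG) => KX.
    have [fC XC FC] := clGF _ XGG.
    have Xb : X \in below GG (cl M (X :|: F)) by rewrite inE XGG.
    have [Y fY XY] := factor_above Xb; have [YGG YC] := mem_factor_below fY.
    exists Y; split=> //; apply: (contr_sub_factor pM wG fF fC FC fY) => //.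
    apply: subset_trans KX _; apply: clS => //; first exact: setSU.
    by rewrite subUset (wb_sub wG).
  move=> /(hat _ GGG)[G' [G'GG KG' GG' G'C]] /(hat _ HGG)[H' [H'GG KH' HH' H'C]].
  have [fG GC FG] := clGF _ GGG; have [fH HC FH] := clGF _ HGG.
  have GE := wb_sub wG GGG; have HE := wb_sub wG HGG.
  have G'E := wb_sub wG G'GG; have H'E := wb_sub wG H'GG.
  have LGG := w1 _ _ _ KGG G'GG H'GG KG' KH'.
  have GHE' : G' :|: H' \subset ground M by rewrite subUset G'E.
  have [fL sL _ minL] := clP pM GHE'; move: sL; rewrite subUset => /andP[G'L H'L].
  apply/imsetP; exists (cl M (G' :|: H')).
    by rewrite inE LGG; apply: contra KF; apply: subset_trans; apply: subset_trans KG' G'L.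
  rewrite cl_contr; last by rewrite subUset !setSD // flat_sub.
  congr (_ :\: F); rewrite /contr_flat cl_setUl //.
  have -> : (cl M (G :|: F) :\: F) :|: (cl M (H :|: F) :\: F) :|: F =
      cl M (G :|: F) :|: cl M (H :|: F).
    by rewrite -setUA setDUK // setUC -[in RHS](setDUK FG) -setUA (setUidPr FH) setUC.
  rewrite cl_setUl ?subUset ?GE // ?flat_sub //.
  apply/eqP; rewrite eqEsubset; apply/andP; split.
    have E1 : G :|: F :|: cl M (H :|: F) \subset ground M.
      by rewrite !subUset GE FE flat_sub.
    have [_ _ _ min1] := clP pM E1; apply: min1.
      by have [] := clP pM (_ : G' :|: H' :|: F \subset ground M); rewrite // subUset GHE'.
    have E2 : G' :|: H' :|: F \subset ground M by rewrite subUset GHE'.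
    have [f2 s2 _ min2] := clP pM E2; move: (s2); rewrite !subUset -andbA => /and3P[a b c].
    rewrite (subset_trans GG' a) c /=; apply: clS => //.
    by apply: setSU; apply: subset_trans HH' (subsetUr _ _).
  have E2 : G' :|: H' :|: F \subset ground M by rewrite subUset GHE'.
  have E1 : G :|: F :|: cl M (H :|: F) \subset ground M.
    by rewrite !subUset GE FE flat_sub.
  have [f1 s1 _ _] := clP pM E1; move: s1; rewrite !subUset -andbA => /and3P[a b c].
  have [_ _ _ min2] := clP pM E2; apply: min2 => //; rewrite !subUset b andbT.
  rewrite (subset_trans H'C c) andbT; apply: subset_trans G'C _.
  have GFE : G :|: F \subset ground M by rewrite subUset GE.
  by have [_ _ _ min3] := clP pM GFE; apply: min3; rewrite // subUset a.
move=> _ /contr_flatsP[D [fD FD ->]].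
have [fE inj] := factors_contr pM wG fF fD FD.
rewrite below_contr // fE big_imset /=; last exact: inj.
rewrite setDUK //.
(* Factors contained in [F] equal their own component and contribute 0, so only the factors of the
   contraction remain. *)
transitivity (\sum_(G in factors (below GG D)) (rk M G - rk M (part GG F G)))%N.
  have h : (\sum_(G in factors (below GG D)) (rk M G - rk M (part GG F G)) +
     \sum_(G in factors (below GG D)) rk M (part GG F G) = \sum_(G in factors (below GG D)) rk M G)%N.
    rewrite -big_split /=; apply: eq_bigr => G /mem_factor_below[GGG _].
    by rewrite subnK // mono ?part_sub // (wb_sub wG).
  by rewrite (w2 _ fD) -h -(rk_flat_parts pM wG fF fD FD) addnK.
rewrite (bigID (fun G => G \subset F)) /= big1 ?add0n => [|G /andP[fG GF]]; last first.
  have [GGG _] := mem_factor_below fG.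
  apply/eqP; rewrite subn_eq0 mono //; last by apply: subset_trans (part_sub _ _ _) (wb_sub wG GGG).
  by apply: (bigcup_sup G); rewrite inE GGG GF subxx.
rewrite [RHS](eq_bigl (fun G => (G \in factors (below GG D)) && ~~ (G \subset F))); last first.
  by move=> G; rewrite in_set.
apply: eq_bigr => G /andP[fG GF].
have [GGG _] := mem_factor_below fG; have GE := wb_sub wG GGG.
have GFE : G :|: F \subset ground M by rewrite subUset GE.
have [_ sC rC _] := clP pM GFE; move: sC; rewrite subUset => /andP[_ FC].
rewrite setDUK // rC (rk_factorU_flat pM wG fF fD FD fG (subxx _)).
have := rk_flat_parts pM wG fF fD FD; rewrite (bigD1 G) //= => ->.
by rewrite (setUidPl (part_sub _ _ _)) subnDr.
Qed.

Lemma building_restr_contr B : B \in flats M -> F \subset B ->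
  building_restr (building_contr M GG F) (B :\: F) =
    building_contr (restriction M B) (building_restr GG B) F.
Proof.
move=> fB FB; rewrite /building_restr below_contr // /building_contr.
apply/setP=> X; apply/imsetP/imsetP => -[G hG ->]; exists G => //; move: hG; rewrite !inE -andbA;
  case/and3P=> GGG GB GF; rewrite join_cl cover2 cl_restr ?subUset ?GB //.
Qed.

Lemma building_contr_contr B : B \in flats M -> F \subset B ->
  building_contr (contraction M F) (building_contr M GG F) (B :\: F) =
    building_contr M GG B.
Proof.
move=> fB FB; rewrite /building_contr; apply/setP=> X.
have BE := flat_sub fB.
have clE G : G \in GG ->
    join (contraction M F) [set join M [set G; F] :\: F; B :\: F] :\: (B :\: F) =
    join M [set G; B] :\: B.
  move=> GGG; rewrite !join_cl !cover2.
  have GE := wb_sub wG GGG.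
  have GFE : G :|: F \subset ground M by rewrite subUset GE.
  have [fC sC _ _] := clP pM GFE; move: sC; rewrite subUset => /andP[_ FC].
  rewrite cl_contr; last by rewrite subUset !setSD // flat_sub.
  rewrite -setUA setDUK // -{1}(setUidPr FB) setUA setDUK //.
  rewrite cl_setUl // -setUA (setUidPr FB).
  apply/setP=> x; rewrite !inE; have := subsetP FB x.
  by case: (x \in F); case: (x \in B) => //= /(_ isT).
apply/imsetP/imsetP => [[Y]|[G]].
  rewrite inE => /andP[/imsetP[G]]; rewrite inE => /andP[GGG GF] ->.
  rewrite join_cl cover2 -/(contr_flat M F G) contr_flat_subD // => GB ->.
  exists G; first by rewrite inE GGG.
  by rewrite -clE // (join_cl M [set G; F]) cover2.
rewrite inE => /andP[GGG GB] ->; exists (join M [set G; F] :\: F); last by rewrite clE.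
rewrite inE join_cl cover2 -/(contr_flat M F G) contr_flat_subD // GB andbT.
apply/imsetP; exists G; last by rewrite join_cl cover2.
by rewrite inE GGG; apply: contra GB => /subset_trans; apply.
Qed.

End Contract.
End Minors.

(** * The Hilbert series of the Chow ring *)

Lemma submod_sub_le u v a b c l : (u + v <= a + b -> l <= u -> c <= v -> c <= b ->
  l - a <= b - c)%N.
Proof. lia. Qed.

Lemma submod_sub_leD u v a b c i g : (u + v <= a + g -> c <= u -> b <= v -> c <= i ->
  b <= g -> i - a <= (i - c) + (g - b))%N.
Proof. lia. Qed.

Section ChowHilbert.
Variables (T : finType) (M : ranked_set T) (GG : {set {set T}}).
Hypotheses (pM : polymatroid M) (wG : weak_building M GG).
Implicit Types (F G H K : {set T}) (S : {set {set T}}).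

(** A union in place of the join [sup_below]: closure does not change the rank ([rk_sup_below]), and
    unions are easier to compare. *)
Definition strictly_below (A : {set {set T}}) G : {set T} := cover [set H in A | H \proper G].

Definition rank_gap (A : {set {set T}}) G : nat := (rk M G - rk M (strictly_below A G))%N.

Lemma strictly_below_sub S G : strictly_below S G \subset G.
Proof. by apply/bigcupsP=> H; rewrite inE => /andP[_ /proper_sub]. Qed.

Lemma strictly_below_sup S G H : H \in S -> H \proper G -> H \subset strictly_below S G.
Proof. by move=> HS HG; apply: (bigcup_sup H); rewrite inE HS. Qed.

Lemma rk_sup_below S G : S \subset GG -> G \in GG ->
  rk M (sup_below M S G) = rk M (strictly_below S G).
Proof.
move=> SGG GGG; rewrite /sup_below join_cl.
have sE : strictly_below S G \subset ground M.
  exact: subset_trans (strictly_below_sub _ _) (wb_sub wG GGG).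
by have [_ _ -> _] := clP pM sE.
Qed.

Local Notation n := #|GG|.
Local Notation fl i := (@enum_val _ (mem GG) i).
Let le : rel 'I_n := fun i j => fl i \subset fl j.
Let im (I : {set 'I_n}) : {set {set T}} := [set fl i | i in I].
Let d (I : {set 'I_n}) (i : 'I_n) : nat := rank_gap (im I) (fl i).
Let lt (i j : 'I_n) := le i j && (i != j).
Implicit Types (I : {set 'I_n}) (i j k l g : 'I_n).

Let flGG i : fl i \in GG. Proof. exact: enum_valP. Qed.
Let flE i : fl i \subset ground M. Proof. exact: (wb_sub wG). Qed.
Let imGG I : im I \subset GG.
Proof. by apply/subsetP=> _ /imsetP[i _ ->]. Qed.
Let fl_inj : injective (fun i : 'I_n => fl i). Proof. exact: enum_val_inj. Qed.
Let mem_im I i : (fl i \in im I) = (i \in I).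
Proof. by rewrite mem_imset. Qed.

Let ltE i j : lt i j = (fl i \proper fl j).
Proof.
rewrite /lt properEneq andbC; congr (_ && _).
by congr (~~ _); apply/eqP/eqP => [->//|]; apply: fl_inj.
Qed.

Let below_subP I i (X : {set T}) : (forall j, j \in I -> lt j i -> fl j \subset X) ->
  strictly_below (im I) (fl i) \subset X.
Proof.
move=> h; apply/bigcupsP=> _ /[!inE] /andP[/imsetP[j jI ->]].
by rewrite -ltE; apply: h.
Qed.

Let below_sup I i j : j \in I -> lt j i -> fl j \subset strictly_below (im I) (fl i).
Proof. by move=> jI ji; apply: strictly_below_sup; rewrite ?mem_im // -ltE. Qed.

Let bE I i : strictly_below (im I) (fl i) \subset ground M.
Proof. exact: subset_trans (strictly_below_sub _ _) (flE i). Qed.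

Let rkS (A B : {set T}) : A \subset B -> B \subset ground M -> (rk M A <= rk M B)%N.
Proof. by case: pM => _ mono _; apply: mono. Qed.

Let rkU (A B : {set T}) : A \subset ground M -> B \subset ground M ->
  (rk M (A :|: B) + rk M (A :&: B) <= rk M A + rk M B)%N.
Proof. by case: pM => _ _; apply. Qed.

Let lt_trans i j k : lt i j -> lt j k -> lt i k.
Proof. by rewrite !ltE; apply: proper_trans. Qed.

Let d_local I i : d I i = d [set j in I | lt j i] i.
Proof.
congr (_ - rk M _)%N; apply/eqP; rewrite eqEsubset; apply/andP.
split; apply: below_subP => j.
  by move=> jI ji; apply: below_sup; rewrite // inE jI.
by rewrite inE => /andP[jI _] ji; apply: below_sup.
Qed.

Let d_anti I I' i : I \subset I' -> (d I' i <= d I i)%N.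
Proof.
move=> sI; apply: leq_sub2l; apply: rkS => //; apply: below_subP => j jI ji.
by apply: below_sup => //; apply: (subsetP sI).
Qed.

Let d_mono I g k i : lt g k -> lt k i -> (d (k |: I) i <= d (g |: I) i)%N.
Proof.
move=> gk ki; apply: leq_sub2l; apply: rkS => //; apply: below_subP => j.
rewrite !inE => /orP[/eqP -> _|jI ji]; last by apply: below_sup; rewrite // !inE jI orbT.
case/andP: gk => gk _; apply: subset_trans gk _; apply: below_sup => //.
by rewrite !inE eqxx.
Qed.

Let d_submod I g i : lt g i -> (d I i <= d (g |: I) i + d I g)%N.
Proof.
move=> gi; rewrite /d /rank_gap.
(* Submodularity for the union [A] below [i] and the flat of [g]: the rank of their union bounds
   that of [C], and their intersection contains [B]. *)
have := rkU (bE I i) (flE g).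
set A := strictly_below _ (fl i); set B := strictly_below _ (fl g).
set C := strictly_below (im (g |: I)) (fl i).
have h1 : (rk M C <= rk M (A :|: fl g))%N.
  apply: rkS; last by rewrite subUset bE flE.
  apply: below_subP => j; rewrite !inE => /orP[/eqP -> _|jI ji]; first exact: subsetUr.
  by apply: subset_trans (subsetUl _ _); apply: below_sup.
have h2 : (rk M B <= rk M (A :&: fl g))%N.
  apply: rkS; last by apply: subset_trans (subsetIr _ _) (flE g).
  rewrite subsetI strictly_below_sub andbT; apply: below_subP => j jI jg.
  by apply: below_sup => //; apply: lt_trans gi.
have h3 : (rk M C <= rk M (fl i))%N by apply: rkS; rewrite ?strictly_below_sub.
have h4 : (rk M B <= rk M (fl g))%N by apply: rkS; rewrite ?strictly_below_sub.
by move=> h; apply: submod_sub_leD h h1 h2 h3 h4.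
Qed.

(** [l] indexes the closure of the union of the two flats, which is in [GG] because both contain the
    flat of [g]. Closure keeps the rank, hence the exponent 0. *)
Let d_join g i k : lt g i -> lt g k -> ~~ le i k -> ~~ le k i ->
  exists l, [/\ le i l, le k l, forall m, le i m -> le k m -> le l m,
    d [set i; k] l = 0%N & forall I, (d (k |: I) l <= d (g |: I) i)%N].
Proof.
move=> gi gk ik ki; have [_ w1 _] := wG.
have gis := proj1 (andP gi); have gks := proj1 (andP gk).
have LGG := w1 _ _ _ (flGG g) (flGG i) (flGG k) gis gks.
have ikE : fl i :|: fl k \subset ground M by rewrite subUset !flE.
have [fL sL rL minL] := clP pM ikE; move: sL; rewrite subUset => /andP[iL kL].
pose l := enum_rank_in LGG (cl M (fl i :|: fl k)).
have flL : fl l = cl M (fl i :|: fl k) by rewrite /l enum_rankK_in.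
have il : lt i l.
  rewrite /lt /le flL iL /=; apply: contra ki => /eqP e.
  by rewrite /le [X in _ \subset fl X]e flL.
have kl : lt k l.
  rewrite /lt /le flL kL /=; apply: contra ik => /eqP e.
  by rewrite /le [X in _ \subset fl X]e flL.
exists l; split.
- by case/andP: il.
- by case/andP: kl.
- move=> m im' km; rewrite /le flL; apply: minL; first exact: (wb_flat wG).
  by rewrite subUset; apply/andP.
- have rl : rk M (fl l) = rk M (fl i :|: fl k) by rewrite flL.
  apply/eqP; rewrite /d /rank_gap subn_eq0 rl; apply: rkS; last exact: bE.
  by rewrite subUset !below_sup // !inE eqxx ?orbT.
move=> I; rewrite /d /rank_gap.
set A := strictly_below (im (k |: I)) (fl l); set C := strictly_below (im (g |: I)) (fl i).
(* [A] contains the flat of [k], so together with that of [i] it reaches the rank of [l]; the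
   intersection contains [C], where [g] enters through [k]. *)
have := rkU (bE (k |: I) l) (flE i); rewrite -/A.
have h1 : (rk M (fl l) <= rk M (A :|: fl i))%N.
  rewrite flL rL; apply: rkS; last by rewrite subUset bE flE.
  rewrite subUset subsetUr /=; apply: subset_trans (subsetUl _ _).
  by apply: below_sup; rewrite // !inE eqxx.
have h2 : (rk M C <= rk M (A :&: fl i))%N.
  apply: rkS; last by apply: subset_trans (subsetIr _ _) (flE i).
  rewrite subsetI strictly_below_sub andbT; apply: below_subP => j.
  rewrite !inE => /orP[/eqP -> _|jI ji].
    by apply: subset_trans gks _; apply: below_sup; rewrite // !inE eqxx.
  apply: below_sup; first by rewrite !inE jI orbT.
  exact: lt_trans il.
have h3 : (rk M C <= rk M (fl i))%N by apply: rkS; rewrite ?strictly_below_sub.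
by move=> h; apply: submod_sub_le h h1 h2 h3.
Qed.

Let chow_pred (SG : {set {set T}} * {set T}) := (SG.1 \subset GG) && (SG.2 \in GG).
Let chow_gen (SG : {set {set T}} * {set T}) := chow_rel M GG SG.1 SG.2.

Let chow_relE I i : chow_rel M GG (im I) (fl i) = exponent_rel le d set0 I i.
Proof.
rewrite /chow_rel /exponent_rel setU0 rk_sup_below //; congr (_ * _).
by apply: eq_bigl => j; rewrite mem_im.
Qed.

Let im_preim S : S \subset GG -> im [set i | fl i \in S] = S.
Proof.
move=> SGG; apply/setP=> H; apply/imsetP/idP => [[i]|HS]; first by rewrite inE => + ->.
have HGG := subsetP SGG _ HS; exists (enum_rank_in HGG H); last by rewrite enum_rankK_in.
by rewrite inE enum_rankK_in.
Qed.

Let chow_pred_im SG : chow_pred SG -> exists I i, SG = (im I, fl i).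
Proof.
case: SG => S G /andP[/= SGG GGG].
by exists [set i | fl i \in S], (enum_rank_in GGG G); rewrite enum_rankK_in // im_preim.
Qed.

Lemma chow_ideal : ideal_gen chow_pred chow_gen =i partial_ideal le d setT set0.
Proof.
move=> p; apply/idP/idP; move: p; apply: ideal_gen_min.
- exact: partial_idealP.
- move=> SG /chow_pred_im[I [i ->]]; rewrite /chow_gen /= chow_relE.
  by apply: (@mem_ideal_gen _ _ _ _ (inl (I, i))); rewrite /= subsetT inE.
- split; [exact: rpred0|exact: rpredD|exact: ideal_genM].
move=> [[I i]|i] /=; last by rewrite inE.
move=> _; rewrite -chow_relE.
by apply: (@mem_ideal_gen _ _ _ _ (im I, fl i)); rewrite /chow_pred /= imGG flGG.
Qed.

Lemma hilbert_weight_sum : hilbert M GG =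
  \sum_(S : {set {set T}} | S \subset GG) \prod_(G in S) weight (rank_gap S G).
Proof.
have le_refl : reflexive le by move=> i; apply: subxx.
have le_anti : antisymmetric le.
  by move=> i j ij; apply: fl_inj; apply/eqP; rewrite eqEsubset.
have le_trans : transitive le by move=> i j k; apply: subset_trans.
have up : forall i j : 'I_n, i \in [set: 'I_n] -> le i j -> j \in [set: 'I_n].
  by move=> i j _ _; rewrite inE.
have [B [_ bB gB]] := partial_ideal_basis le_refl le_anti le_trans d_local d_anti
  d_mono d_submod d_join set0 up.
have cB := monomial_basis_ext chow_ideal bB.
have hom SG : chow_pred SG -> exists e, chow_gen SG \is e.-homog.
  move=> /chow_pred_im[I [i ->]]; rewrite /chow_gen /= chow_relE.
  apply: (@partial_gen_homog _ le d setT set0 (inl (I, i))).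
  by rewrite /= subsetT inE.
have -> : hilbert M GG = degree_gf B.
  apply/polyP=> e; rewrite hilbert_coef coef_degree_gf; congr (_%:R).
  by apply: dimensionE; apply: (monomial_basis_dim hom e cB).
rewrite gB /weight_sum.
rewrite [RHS](reindex_onto im (fun S => [set i | fl i \in S])) /=; last exact: im_preim.
apply: eq_big => [I|I _].
  rewrite subsetT imGG; apply/esym/eqP/setP=> i.
  by rewrite inE mem_im.
rewrite big_imset /=; last by move=> i j _ _; apply: fl_inj.
by apply: eq_bigr => i _; rewrite setU0.
Qed.

End ChowHilbert.

(** * Moebius inversion and characteristic polynomials *)

Section SubsetSums.
Variable I : finType.
Implicit Types (A B S : {set I}).

Lemma prod_1D_subsets (R : comNzRingType) B (F : I -> R) :
  \prod_(i in B) (1 + F i) = \sum_(S : {set I} | S \subset B) \prod_(i in S) F i.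
Proof.
have [k] := ubnP #|B|; elim: k B => // k IH B; rewrite ltnS => leB.
have [->|/set0Pn[i iB]] := eqVneq B set0.
  by rewrite big_set0 (big_pred1 set0) ?big_set0 // => S; rewrite subset0.
rewrite -(setD1K iB); set B' := B :\ i.
have iB' : i \notin B' by rewrite !inE eqxx.
rewrite big_setU1 //= big_subsets_setU1 // IH; last first.
  by apply: leq_trans leB; rewrite (cardsD1 i B) iB.
rewrite mulrDl mul1r mulr_sumr; congr (_ + _); apply: eq_bigr => S SB'.
by rewrite big_setU1 //; apply: contra iB' => /(subsetP SB').
Qed.

Lemma big_subsets_setU (V : nmodType) A B (F : {set I} -> V) : [disjoint A & B] ->
  \sum_(S : {set I} | S \subset A :|: B) F S =
    \sum_(S1 : {set I} | S1 \subset A) \sum_(S2 : {set I} | S2 \subset B) F (S1 :|: S2).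
Proof.
move=> dAB; rewrite pair_big /=.
rewrite (reindex_onto (fun p : {set I} * {set I} => p.1 :|: p.2)
  (fun S : {set I} => (S :&: A, S :&: B))) /=; last first.
  by move=> S SAB; rewrite -setIUr (setIidPl SAB).
apply: eq_bigl => -[S1 S2] /=; apply/andP/andP => [[sAB /eqP[<- <-]]|[s1 s2]].
  by split; apply: subsetIr.
have AB0 : A :&: B = set0 by apply/eqP; rewrite setI_eq0.
split; first exact: setUSS.
apply/eqP; congr (_, _); rewrite setIUl.
  rewrite (setIidPl s1); apply/setUidPl; apply: subset_trans (sub0set _).
  by rewrite -AB0 setIC setIS.
rewrite (setIidPl s2); apply/setUidPr; apply: subset_trans (sub0set _).
by rewrite -AB0 setSI.
Qed.

(** Functions on pairs from [P] are square matrices, for which a one-sided inverse is two-sided. *)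
Lemma convolution_inverse (R : comUnitRingType) (P : {set I}) (a b : I -> I -> R) :
  {in P &, forall x y, \sum_(z in P) a x z * b z y = (x == y)%:R} ->
  {in P &, forall x y, \sum_(z in P) b x z * a z y = (x == y)%:R}.
Proof.
pose ev (i : 'I_#|P|) : I := enum_val i.
pose mx (c : I -> I -> R) := \matrix_(i < #|P|, j < #|P|) c (ev i) (ev j).
have mulE c d i j : (mx c *m mx d) i j = \sum_(z in P) c (ev i) z * d z (ev j).
  by rewrite mxE [RHS]big_enum_val; apply: eq_bigr => k _; rewrite !mxE.
move=> ab; have /mulmx1C ba : mx a *m mx b = 1%:M.
  by apply/matrixP=> i j; rewrite mulE ab ?enum_valP // mxE (inj_eq enum_val_inj).
move=> x y xP yP; have /matrixP/(_ (enum_rank_in xP x) (enum_rank_in xP y)) := ba.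
rewrite mulE mxE /ev !enum_rankK_in // => ->; congr (_%:R).
by rewrite -(inj_eq enum_val_inj) !enum_rankK_in.
Qed.

End SubsetSums.

Section Moebius.
Variables (T : finType) (P : {set {set T}}).
Implicit Types A B C : {set T}.

Lemma mobius_sumr A B : A \in P -> B \in P -> A \subset B ->
  \sum_(C in P | (A \subset C) && (C \subset B)) mobius P A C = (A == B)%:R.
Proof.
move=> AP BP AB; rewrite (bigD1 B) /=; last by rewrite BP AB subxx.
rewrite mobiusE; have [->|AB'] := eqVneq A B.
  rewrite big1 ?addr0 // => C /andP[/and3P[_ BC CB] /negP[]].
  by rewrite eqEsubset CB BC.
rewrite addrC; apply/eqP; rewrite subr_eq0; apply/eqP; apply: eq_bigl => C.
by rewrite properEneq; case: (C \in P) => //=; rewrite -andbA; congr (_ && _); rewrite andbC.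
Qed.

(** The recursion makes [mobius] inverse to the zeta function on one side; [convolution_inverse]
    gives the other side. *)
Lemma mobius_suml A B : A \in P -> B \in P -> A \subset B ->
  \sum_(C in P | (A \subset C) && (C \subset B)) mobius P C B = (A == B)%:R.
Proof.
move=> AP BP AB.
pose a A C : int := if A \subset C then mobius P A C else 0.
pose b C B : int := (C \subset B)%:R.
have ab : {in P &, forall A B, \sum_(C in P) a A C * b C B = (A == B)%:R}.
  move=> {AB}A' B' AP' BP'; have [AB|AB] := boolP (A' \subset B').
    rewrite -mobius_sumr // big_mkcondr; apply: eq_bigr => C _; rewrite /a /b.
    by case: (A' \subset C); case: (C \subset B'); rewrite ?mulr1 ?mulr0 ?mul0r.
  have -> : (A' == B') = false by apply/eqP=> e; rewrite e subxx in AB.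
  rewrite big1 // => C _; rewrite /a /b; case: ifP => [AC|_]; last by rewrite mul0r.
  have -> : (C \subset B') = false by apply/negP=> /(subset_trans AC); apply/negP.
  by rewrite mulr0.
rewrite -(convolution_inverse ab AP BP) big_mkcondr; apply: eq_bigr => C _; rewrite /a /b.
by case: (A \subset C); case: (C \subset B); rewrite ?mul1r ?mulr0 ?mul0r.
Qed.

End Moebius.

Section CharacteristicPolynomial.
Variables (T : finType) (M : ranked_set T).
Hypothesis pM : polymatroid M.
Implicit Types A B C D F : {set T}.

Lemma big_contr_flats (V : nmodType) F (Q : pred {set T}) (h : {set T} -> V) :
  F \in flats M ->
  \sum_(C in flats (contraction M F) | Q C) h C =
    \sum_(D in flats M | (F \subset D) && Q (D :\: F)) h (D :\: F).
Proof.
move=> fF; rewrite big_mkcondr contraction_flats // big_imset /=; last first.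
  move=> A B; rewrite !inE => /and3P[_ FA _] /and3P[_ FB _] e.
  by rewrite -(setDUK FA) -(setDUK FB) e.
rewrite -big_mkcondr; apply: eq_bigl => D; rewrite inE.
by case fD : (D \in flats M) => //=; rewrite (flat_sub fD) andbT.
Qed.

Lemma setDS_proper F C D : F \subset C -> F \subset D ->
  (C :\: F \proper D :\: F) = (C \proper D).
Proof.
move=> FC FD; have sub A B : F \subset A -> F \subset B ->
    (A :\: F \subset B :\: F) = (A \subset B).
  move=> FA FB; apply/idP/idP => [s|]; last exact: setSD.
  by rewrite -(setDUK FA) -(setDUK FB) setSU.
by rewrite !properE !sub.
Qed.

Lemma mobius_contr F D : F \in flats M -> D \in flats M -> F \subset D ->
  mobius (flats (contraction M F)) set0 (D :\: F) = mobius (flats M) F D.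
Proof.
move=> fF; have [k] := ubnP #|D|; elim: k D => // k IH D; rewrite ltnS => leD fD FD.
rewrite mobiusE [RHS]mobiusE eq_sym setD_eq0.
have -> : (D \subset F) = (F == D) by rewrite eqEsubset FD.
case: eqP => // _; congr (- _); rewrite big_contr_flats //.
apply: eq_big => [C|C /andP[fC /and3P[FC _ CD]]].
  by rewrite sub0set /=; case FC : (F \subset C); rewrite ?andbF //= setDS_proper.
rewrite setDS_proper // in CD; apply: IH => //.
exact: leq_trans (proper_card CD) leD.
Qed.

Lemma chi_contraction F : F \in flats M -> chi (contraction M F) =
  \sum_(D in flats M | F \subset D)
    (mobius (flats M) F D)%:~R *: 'X^(rk M (ground M) - rk M D).
Proof.
move=> fF; have [_ mono _] := pM; have FE := flat_sub fF.
rewrite /chi (eq_bigl (fun C => (C \in flats (contraction M F)) && true)); last first.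
  by move=> C; rewrite andbT.
rewrite (big_contr_flats (fun=> true)) //.
under eq_bigl do rewrite andbT.
apply: eq_bigr => D /andP[fD FD]; rewrite mobius_contr //= !setDUK //; congr (_ *: 'X^_).
have := mono F D FD (flat_sub fD); have := mono _ _ (flat_sub fD) (subxx _); lia.
Qed.

(** After exchanging sums, the coefficient of each flat [D] is a Moebius sum over the interval from
    [cl M A] to [D], so only [D = cl M A] survives. *)
Lemma sum_chi_contraction A : A \subset ground M ->
  \sum_(F in flats M | A \subset F) chi (contraction M F) =
    'X^(rk M (ground M) - rk M A).
Proof.
move=> AE; have [fC sC rC minC] := clP pM AE; rewrite -rC.
have clE F : F \in flats M -> (A \subset F) = (cl M A \subset F).
  by move=> fF; apply/idP/idP => [AF|]; [apply: minC|apply: subset_trans].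
rewrite (eq_bigr _ (fun F h => chi_contraction (proj1 (andP h)))).
rewrite (exchange_big_dep (fun D => (D \in flats M) && (cl M A \subset D))) /=; last first.
  move=> F D /andP[fF AF] /andP[-> FD]; rewrite clE // in AF.
  exact: subset_trans AF FD.
rewrite (bigD1 (cl M A)) /=; last by rewrite fC subxx.
have inner D : D \in flats M -> cl M A \subset D ->
    \sum_(F in flats M | (A \subset F) && (D \in flats M) && (F \subset D))
      (mobius (flats M) F D)%:~R *: 'X^(rk M (ground M) - rk M D) =
    (cl M A == D)%:R *: 'X^(rk M (ground M) - rk M D) :> {poly rat}.
  move=> fD AD; rewrite -scaler_suml; congr (_ *: _).
  rewrite -raddf_sum /= -(mulrz_nat (cl M A == D)) -(mobius_suml fC fD AD).
  congr (_%:~R); apply: eq_bigl => F; case fF : (F \in flats M) => //=.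
  by rewrite fD andbT clE.
transitivity ((cl M A == cl M A)%:R *: 'X^(rk M (ground M) - rk M (cl M A)) : {poly rat}).
  rewrite -[LHS]/(_ + _); rewrite -[RHS]addr0; congr (_ + _).
    rewrite -inner //; apply: eq_bigl => F; by rewrite -!andbA.
  rewrite big1 // => D /andP[/andP[fD AD] DA].
  rewrite (eq_bigl (fun F => (F \in flats M) && ((A \subset F) && (D \in flats M) && (F \subset D)))).
    by rewrite inner // eq_sym (negPf DA) scale0r.
  by move=> F; rewrite -!andbA.
by rewrite eqxx scale1r.
Qed.

End CharacteristicPolynomial.

(** * The two convolution identities *)

Lemma weight_geom b : (1 - 'X) * (1 + weight b) = 1 - 'X^b.
Proof.
case: b => [|b]; first by rewrite /weight expr0 subrr mulr0.
have -> : 1 + weight b.+1 = \sum_(i < b.+1) 'X^i.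
  by rewrite /weight -(big_mkord xpredT (fun i => 'X^i)) big_nat_recl // big_add1.
by rewrite -opprB mulNr -subrX1 opprB.
Qed.

Section Convolution.
Variables (T : finType) (M : ranked_set T) (GG : {set {set T}}).
Hypotheses (pM : polymatroid M) (wG : weak_building M GG).
Implicit Types (E F G H : {set T}) (S U : {set {set T}}).
Local Notation f := (factors GG).
Local Notation inner := (GG :\: factors GG).
Local Notation gap := (rank_gap M).
Local Notation fbelow F := [set E in f | E \subset F].

Lemma factors_sub : f \subset GG.
Proof. by apply/subsetP=> E /factorsP[]. Qed.

Lemma factor_maximal E G : E \in f -> G \in GG -> (E \proper G) = false.
Proof.
move=> /factorsP[_ max] GGG; apply/negP=> /andP[EG /negP]; apply.
by rewrite (max _ GGG EG).
Qed.

Lemma gap_setU_factors S U G : G \in GG -> U \subset f -> gap (S :|: U) G = gap S G.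
Proof.
move=> GGG Uf; congr (_ - rk M (cover _))%N; apply/setP=> H; rewrite !inE.
have [HU|_] := boolP (H \in U); last by rewrite orbF.
by rewrite (factor_maximal (subsetP Uf _ HU) GGG) !andbF.
Qed.

Lemma cover_subset S F : (cover S \subset F) = [forall G in S, G \subset F].
Proof.
apply/bigcupsP/forall_inP => h G; [exact: h|exact: h].
Qed.

(** Each maximal element of [GG] inside [F] contributes [1 + weight], which one factor [1 - 'X]
    turns into [1 - 'X^gap]; the product is then expanded again over [U]. The condition on [F] sits
    in the summand so that the index sets are the same for all [F]. Note that [fbelow F] holds
    factors of [GG], not those of the restriction. *)
Lemma hilbert_restr F : F \in flats M ->
  hilbert (restriction M F) (building_restr GG F) * (1 - 'X) ^+ #|fbelow F| =
  \sum_(S : {set {set T}} | S \subset inner)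
    \sum_(U : {set {set T}} | U \subset f)
      if (cover S :|: cover U \subset F) then
      \prod_(G in S) weight (gap S G) * \prod_(E in U) - 'X^(gap S E) else 0.
Proof.
move=> fF.
rewrite (hilbert_weight_sum (restriction_polymatroid pM (flat_sub fF))
  (weak_building_restr pM fF wG)).
pose inF := [set G in inner | G \subset F].
have inFE G : (G \in inF) = [&& G \notin f, G \in GG & G \subset F].
  by rewrite in_set in_setD andbA.
have fbE G : (G \in fbelow F) = (G \in f) && (G \subset F) by rewrite in_set.
have dF : [disjoint inF & fbelow F].
  rewrite -setI_eq0; apply/eqP/setP=> G; rewrite in_set0 in_setI inFE fbE.
  by case: (G \in f); rewrite ?andbF.
have bF : building_restr GG F = inF :|: fbelow F.
  apply/setP=> G; rewrite in_setU inFE fbE in_set.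
  case: (boolP (G \in f)) => [/(subsetP factors_sub)->//|_] /=.
  by rewrite orbF.
rewrite bF big_subsets_setU // mulr_suml.
have subF (A : {set {set T}}) S : (S \subset [set G in A | G \subset F]) =
    (S \subset A) && (cover S \subset F).
  rewrite cover_subset; apply/subsetP/andP => [h|[/subsetP h1 /forall_inP h2] G GS].
    split; first by apply/subsetP=> G /h; rewrite in_set => /andP[].
    by apply/forall_inP=> G /h; rewrite in_set => /andP[].
  by rewrite in_set h1 // h2.
rewrite (eq_bigl _ _ (subF inner)) big_mkcondr /=; apply: eq_bigr => S Sin.
have SGG : S \subset GG by apply: subset_trans Sin (subsetDl _ _).
case: ifP => SF; last first.
  by rewrite big1 // => U _; rewrite subUset SF.
transitivity (\prod_(G in S) weight (gap S G) * \prod_(E in fbelow F) (1 - 'X^(gap S E))).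
  rewrite -(eq_bigr _ (fun E _ => weight_geom (gap S E))) big_split /= prodr_const.
  rewrite prod_1D_subsets [X in _ = _ * X]mulrC mulrA; congr (_ * _).
  rewrite mulr_sumr; apply: eq_bigr => U Uf.
  have {}Uf : U \subset f by apply: subset_trans Uf _; apply/subsetP=> G; rewrite in_set => /andP[].
  have dSU : [disjoint S & U].
    rewrite -setI_eq0; apply/eqP/setP=> G; rewrite in_set0 in_setI.
    apply/andP=> -[/(subsetP Sin)]; rewrite in_setD => /andP[/negP nG _] /(subsetP Uf).
    exact: nG.
  rewrite (eq_bigl (mem [predU S & U])) ?bigU //=; last by move=> G; rewrite !inE.
  congr (_ * _); apply: eq_bigr => G GS.
    by rewrite -[rank_gap _ _ _]/(gap (S :|: U) G) gap_setU_factors // (subsetP SGG).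
  by rewrite -[rank_gap _ _ _]/(gap (S :|: U) G) gap_setU_factors // (subsetP factors_sub) // (subsetP Uf).
rewrite prod_1D_subsets mulr_sumr (eq_bigl _ _ (subF f)) big_mkcondr /=.
by apply: eq_bigr => U _; rewrite subUset SF.
Qed.

Lemma rk_ground_factors : rk M (ground M) = (\sum_(E in f) rk M E)%N.
Proof. by have [_ _ w2] := wG; rewrite w2 ?ground_flat // (below_ground wG). Qed.

(** By modularity the rank missing from the union is the sum of the gaps of the factors outside [U];
    those in [U] supply the remaining terms. *)
Lemma gap_exponent S U : S \subset inner -> U \subset f ->
  (\sum_(E in U) gap S E + (rk M (ground M) - rk M (cover S :|: cover U)))%N =
  (\sum_(E in f) gap S E)%N.
Proof.
move=> Sin Uf; have [_ mono _] := pM.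
have SGG : S \subset GG by apply: subset_trans Sin (subsetDl _ _).
pose a E := if E \in U then E else strictly_below S E.
have aE E : a E \subset E by rewrite /a; case: ifP => // _; apply: strictly_below_sub.
have fE E : E \in f -> E \subset ground M by move=> /(subsetP factors_sub)/(wb_sub wG).
have -> : cover S :|: cover U = \bigcup_(E in f) a E.
  apply/eqP; rewrite eqEsubset subUset -andbA; apply/and3P; split.
  - apply/bigcupsP=> G GS; have GGG := subsetP SGG _ GS.
    have [E fEE GE] := factor_above GGG; apply: subset_trans (bigcup_sup E fEE).
    rewrite /a; case: ifP => // _; apply: strictly_below_sup => //.
    rewrite properEneq GE andbT; apply/eqP=> e.
    by have := subsetP Sin _ GS; rewrite in_setD e fEE.
  - by apply/bigcupsP=> E EU; apply: subset_trans (bigcup_sup E (subsetP Uf _ EU)); rewrite /a EU.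
  apply/bigcupsP=> E fEE; rewrite /a; case: ifP => EU.
    by apply: subset_trans (subsetUr _ _); apply: (bigcup_sup E).
  apply: subset_trans (subsetUl _ _); apply/bigcupsP=> H; rewrite inE => /andP[HS _].
  exact: (bigcup_sup H).
have -> : rk M (\bigcup_(E in f) a E) = (\sum_(E in f) rk M (a E))%N.
  by have := modular_factors pM wG (ground_flat M); rewrite (below_ground wG); apply.
rewrite rk_ground_factors -sumnB => [|E fEE]; last by apply: mono => //; apply: fE.
rewrite [X in (_ + X)%N = _](big_setID U) /= [RHS](big_setID U) /= (setIidPr Uf).
congr (_ + _)%N; rewrite big1 ?add0n => [|E EU]; last by rewrite /a EU subnn.
by apply: eq_bigr => E; rewrite in_setD /a => /andP[/negPf-> _].
Qed.

Lemma hilbert_chi_sum : ground M != set0 -> loopless M ->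
  \sum_(F in flats M) hilbert (restriction M F) (building_restr GG F)
    * (1 - 'X) ^+ #|fbelow F| * chi (contraction M F) = 0.
Proof.
move=> E0 lM.
(* Without factors the ground set would have rank 0, and each of its elements would be a loop. *)
have f0 : exists E, E \in f.
  apply/set0Pn; apply: contraL lM => /eqP f0.
  have [e eE] := set0Pn _ E0; apply/negP=> /flatsP[_ /(_ e eE)]; rewrite in_set0 => /(_ isT).
  have [rk0 mono _] := pM; have := rk_ground_factors; rewrite f0 big_set0 => rE.
  have := mono (e |: set0) (ground M); rewrite subUset sub1set eE sub0set rE rk0.
  by move=> /(_ isT (subxx _)); rewrite leqn0 => /eqP ->.
under eq_bigr => F fF do rewrite hilbert_restr // mulr_suml.
rewrite exchange_big /= big1 // => S Sin.
under eq_bigr => F fF do rewrite mulr_suml.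
rewrite exchange_big /=.
have SGG : S \subset GG by apply: subset_trans Sin (subsetDl _ _).
have cE (A : {set {set T}}) : A \subset GG -> cover A \subset ground M.
  by move=> /subsetP AG; apply/bigcupsP=> G /AG /(wb_sub wG).
pose w := \prod_(G in S) weight (gap S G).
rewrite (eq_bigr (fun U : {set {set T}} =>
    w * 'X^(\sum_(E in f) gap S E)%N * \prod_(E in U) (-1))); last first.
  move=> U Uf; have UGG := subset_trans Uf factors_sub.
  transitivity (\sum_(F in flats M | cover S :|: cover U \subset F)
    w * \prod_(E in U) - 'X^(gap S E) * chi (contraction M F)).
    rewrite [RHS]big_mkcondr; apply: eq_bigr => F _.
    by case: ifP => _; rewrite ?mul0r.
  rewrite -mulr_sumr sum_chi_contraction ?subUset ?cE //.
  rewrite -(gap_exponent Sin Uf) exprD.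
  have -> : \prod_(E in U) - 'X^(gap S E) =
      \prod_(E in U) (-1) * 'X^(\sum_(E in U) gap S E)%N :> {poly rat}.
    rewrite -[in RHS]prodrXr -big_split /=.
    by apply: eq_bigr => E _; rewrite mulN1r.
  by rewrite -!mulrA; congr (_ * _); rewrite [LHS]mulrC -mulrA.
(* The remaining sum of signs over [U] is a product of factors [1 + (-1)], nonempty by [f0]. *)
rewrite -mulr_sumr -prod_1D_subsets; have [E fE] := f0.
by rewrite [X in _ * X](bigD1 E) //= subrr mul0r mulr0.
Qed.

End Convolution.

(** * The second identity as a convolution with value 0 or 1 *)

Section Inversion.
Variables (T : finType) (M : ranked_set T) (GG : {set {set T}}).
Hypotheses (pM : polymatroid M) (wG : weak_building M GG) (lM : loopless M).
Implicit Types (A B C F G H : {set T}).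

Definition reduced_chi (N : ranked_set T) (HH : {set {set T}}) : {fraction {poly rat}} :=
  tofrac (chi N) / tofrac (1 - 'X) ^+ #|factors HH|.

Lemma tofrac_1subX_neq0 : tofrac (1 - 'X : {poly rat}) != 0.
Proof.
rewrite tofrac_eq0 subr_eq0; apply/eqP=> e.
by have := size_polyX rat; rewrite -e size_poly1.
Qed.

Lemma below_set0 : below GG set0 = set0.
Proof.
apply/setP=> G; rewrite !inE subset0; apply/andP=> -[GGG /eqP G0].
by have := wb_neq0 wG GGG; rewrite G0 eqxx.
Qed.

Lemma building_contr_set0 : building_contr M GG set0 = GG.
Proof.
rewrite building_contrE; apply/setP=> G; apply/imsetP/idP => [[H]|GGG].
  by rewrite inE /contr_flat setU0 setD0 => /andP[HGG _] ->; rewrite cl_id // (wb_flat wG).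
exists G; first by rewrite inE GGG subset0 (wb_neq0 wG).
by rewrite /contr_flat setU0 setD0 cl_id // (wb_flat wG).
Qed.

Lemma factors_set0 : factors (set0 : {set {set T}}) = set0.
Proof. by apply/setP=> G; rewrite in_set0; apply/factorsP=> -[]; rewrite in_set0. Qed.

(** For a nonempty ground set this is [hilbert_chi_sum] after division by
    [(1 - 'X) ^+ #|factors GG|]. The empty ground set provides the diagonal entries of the incidence
    algebra. *)
Lemma hilbert_chi_delta :
  \sum_(F in flats M) tofrac (hilbert (restriction M F) (building_restr GG F))
    * reduced_chi (contraction M F) (building_contr M GG F) = (set0 == ground M)%:R.
Proof.
have [E0|E0] := eqVneq set0 (ground M).
  have fl0 F : (F \in flats M) = (F == set0).
    apply/idP/eqP => [/flat_sub|->]; last by [].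
    by rewrite -E0 subset0 => /eqP.
  rewrite (big_pred1 set0) // /reduced_chi building_contr_set0 /building_restr below_set0.
  rewrite hilbert_set0 tofrac1 mul1r.
  have -> : GG = set0 by rewrite -[RHS]below_set0 E0 (below_ground wG).
  rewrite factors_set0 cards0 expr0 divr1 -[RHS]tofrac1; congr tofrac.
  have := sum_chi_contraction pM (sub0set _); rewrite (big_pred1 set0).
    by move=> ->; rewrite -E0 subnn expr0.
  by move=> F; rewrite /= sub0set andbT fl0.
have Y0 := tofrac_1subX_neq0; set Y := tofrac _ in Y0.
apply: (mulIf (expf_neq0 #|factors GG| Y0)); rewrite mul0r mulr_suml.
rewrite -[RHS]tofrac0 -(hilbert_chi_sum pM wG _ lM) 1?eq_sym // raddf_sum /=.
apply: eq_bigr => F fF; rewrite !tofracM tofracXn -/Y /reduced_chi card_factors_contr //.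
(* Factors inside [F] account for the power in [hilbert_chi_sum], the others for the denominator of
   [reduced_chi]. *)
have -> : #|factors GG| = (#|[set E in factors GG | E \subset F]| +
    #|[set G in factors GG | ~~ (G \subset F)]|)%N.
  rewrite -(cardsID [set E : {set T} | E \subset F] (factors GG)); congr (_ + _)%N;
    apply: eq_card => G; rewrite ?in_setI ?in_setD [RHS]in_set in_set //.
  by rewrite andbC.
rewrite exprD -!mulrA; congr (_ * _).
by rewrite [X in _ * X]mulrCA mulVf ?expf_neq0 // mulr1 mulrC.
Qed.

End Inversion.

(** * Inversion in the incidence algebra of the lattice of flats *)

Section Incidence.
Variables (T : finType) (M : ranked_set T) (GG : {set {set T}}).
Hypotheses (pM : polymatroid M) (wG : weak_building M GG) (lM : loopless M).
Implicit Types (A B C F G H : {set T}).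

Local Notation minor A B := (contraction (restriction M B) A).
Local Notation minorG A B := (building_contr (restriction M B) (building_restr GG B) A).

Let h A B : {fraction {poly rat}} :=
  if A \subset B then tofrac (hilbert (minor A B) (minorG A B)) else 0.
Let c A B : {fraction {poly rat}} :=
  if A \subset B then reduced_chi (minor A B) (minorG A B) else 0.

(** This is [hilbert_chi_delta] for the minor on the interval from [A] to [B], whose own
    restrictions and contractions are the minors on the two subintervals cut off by [C], building
    sets included. *)
Lemma minor_convolution A B : A \in flats M -> B \in flats M ->
  \sum_(C in flats M) h A C * c C B = (A == B)%:R.
Proof.
move=> fA fB; have [AB|AB] := boolP (A \subset B); last first.
  rewrite big1 => [|C _]; first by case: eqP => // e; rewrite e subxx in AB.
  rewrite /h /c; case: ifP => AC; rewrite ?mul0r //; case: ifP => CB; rewrite ?mulr0 //.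
  by rewrite (subset_trans AC CB) in AB.
have BE := flat_sub fB; have pB := restriction_polymatroid pM BE.
have wB := weak_building_restr pM fB wG.
have fAB : A \in flats (restriction M B) by rewrite flats_restr // fA.
have pN := contraction_polymatroid pB AB.
have wN := weak_building_contr pB fAB wB.
have lN := contraction_loopless pB fAB.
have := hilbert_chi_delta pN wN lN.
have -> : (set0 == ground (minor A B)) = (A == B).
  by rewrite /= eq_sym setD_eq0 eqEsubset AB.
move=> <-; rewrite [RHS](eq_bigl (fun C => (C \in flats (minor A B)) && true)); last first.
  by move=> C; rewrite andbT.
rewrite (big_contr_flats pB (fun=> true)) //.
rewrite (bigID (fun C => (A \subset C) && (C \subset B))) /= [X in _ + X]big1 ?addr0; last first.
  move=> C /andP[_]; rewrite negb_and /h /c.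
  by case/orP=> /negPf->; rewrite ?mul0r ?mulr0.
apply: eq_big => [C|C /andP[fC /andP[AC CB]]].
  rewrite (flats_restr _ pM fB).
  by case: (C \in flats M); case: (A \subset C); case: (C \subset B).
rewrite /h /c AC CB.
have fCB : C \in flats (restriction M B) by rewrite flats_restr // fC.
rewrite (building_restr_contr pB fAB wB fCB AC) (building_contr_contr pB fAB wB fCB AC).
rewrite (contraction_contraction pB AC CB).
by rewrite /building_restr below_below.
Qed.

Lemma chi_hilbert_delta :
  \sum_(F in flats M) reduced_chi (restriction M F) (building_restr GG F)
    * tofrac (hilbert (contraction M F) (building_contr M GG F)) = (set0 == ground M)%:R.
Proof.
have hc : {in flats M &, forall A B, \sum_(C in flats M) h A C * c C B = (A == B)%:R}.
  by move=> A B; apply: minor_convolution.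
have [rk0 _ _] := pM.
rewrite -(convolution_inverse hc lM (ground_flat M)); apply: eq_bigr => F fF.
rewrite /h /c sub0set (flat_sub fF) restriction_ground /building_restr (below_ground wG).
rewrite contraction_set0 //; congr (reduced_chi _ _ * _).
by rewrite (building_contr_set0 (weak_building_restr pM fF wG)).
Qed.

End Incidence.

Theorem theorem1p1 (T : finType) (M : ranked_set T) (GG : {set {set T}})
    (M_polymatroid : polymatroid M) (M_nonempty : ground M != set0)
    (M_loopless : loopless M) (GG_building : building_set M GG) :
  tofrac (hilbert M GG) =
    \sum_(F in flats M | F != set0)
      tofrac (- chi (restriction M F))
        / tofrac (1 - 'X) ^+ #|factors (building_restr GG F)|
        * tofrac (hilbert (contraction M F) (building_contr M GG F))
  /\
  tofrac (hilbert M GG) =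
    \sum_(F in flats M | F != ground M)
      tofrac (hilbert (restriction M F) (building_restr GG F))
        * (tofrac (- chi (contraction M F))
            / tofrac (1 - 'X) ^+ #|factors (building_contr M GG F)|).
Proof.
have wG := building_weak M_polymatroid M_loopless GG_building.
have E0 : (set0 == ground M) = false by rewrite eq_sym; apply: negbTE.
have [rk0 _ _] := M_polymatroid.
split.
  (* The term at [set0] is the Hilbert series of [M] itself; moving the other terms across produces
     the minus signs. *)
  have := chi_hilbert_delta M_polymatroid wG M_loopless; rewrite E0.
  rewrite (bigD1 set0) //= contraction_set0 // (building_contr_set0 wG).
  rewrite /building_restr (below_set0 wG) /reduced_chi factors_set0 cards0 expr0 divr1.
  have -> : chi (restriction M set0) = 1.
    rewrite /chi (big_pred1 set0); first by rewrite mobiusE eqxx scale1r subnn expr0.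
    move=> F; rewrite flats_restr //; apply/andP/eqP => [[_]|->]; last by rewrite subxx.
    by rewrite subset0 => /eqP.
  rewrite tofrac1 mul1r => /eqP; rewrite addr_eq0 => /eqP ->; rewrite -sumrN.
  by apply: eq_bigr => F _; rewrite tofracN !mulNr.
(* Here the Hilbert series of [M] is the term at the ground set, where the contraction is empty and
   its reduced characteristic polynomial is 1. *)
have := hilbert_chi_delta M_polymatroid wG M_loopless; rewrite E0.
rewrite (bigD1 (ground M)) ?ground_flat //= restriction_ground /building_restr (below_ground wG).
have -> : reduced_chi (contraction M (ground M)) (building_contr M GG (ground M)) = 1.
  have -> : building_contr M GG (ground M) = set0.
    apply/setP=> X; rewrite in_set0; apply/imsetP=> -[G]; rewrite inE => /andP[GGG].
    by rewrite (wb_sub wG GGG).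
  rewrite /reduced_chi factors_set0 cards0 expr0 divr1 -[RHS]tofrac1; congr tofrac.
  have := sum_chi_contraction M_polymatroid (subxx _); rewrite (big_pred1 (ground M)).
    by move=> ->; rewrite subnn expr0.
  move=> F; apply/andP/eqP => [[/flat_sub FE EF]|->]; last by rewrite ground_flat.
  by apply/eqP; rewrite eqEsubset FE.
rewrite mulr1 => /eqP; rewrite addr_eq0 => /eqP ->; rewrite -sumrN.
by apply: eq_bigr => F _; rewrite tofracN mulNr mulrN.
Qed.
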